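(* Let $\mathcal X,\mathcal Z$ be Polish spaces, $d$ the metric of $\mathcal X$, let $S:\mathcal X\times\mathcal Z\to\mathcal X$ be locally Lipschitz (Lipschitz on bounded sets), and let $\{\xi_n\}_{n\ge 0}$ be i.i.d. $\mathcal Z$-valued random variables with common law $\ell$. Consider the Markov process $x_{n+1}=S(x_n,\xi_n)$, $x_0=x\in\mathcal X$, with transition functions $P_n(x,\cdot)$ and dual semigroup $P_n^*$. Assume that $\mathcal E:=\operatorname{supp}\ell$ is compact in $\mathcal Z$ and that the following three hypotheses hold. (AC) There exist a compact set $\mathcal Y\subset\mathcal X$, a constant $\kappa>0$ and a measurable function $V:\mathcal X\to[0,\infty)$, bounded on bounded sets, such that $\operatorname{dist}(S_n(x;\boldsymbol\zeta),\mathcal Y)\le V(x)e^{-\kappa n}$ for all $x\in\mathcal X$, $\boldsymbol\zeta\in\mathcal E^{\mathbb N}$, $n\ge 1$. (I) There exists $z\in\mathcal Y$ such that for every $\varepsilon>0$ there is an integer $m=m(\varepsilon)\ge 1$ with $\inf_{x\in\mathcal Y_\infty}P_m(x,B(z,\varepsilon))>0$. (C) There exists $r\in[0,1)$ such that for all $x,x'\in\mathcal Y_\infty$ there is a coupling $(\mathcal R(x,x'),\mathcal R'(x,x'))$ of $P_1(x,\cdot)$ and $P_1(x',\cdot)$, defined on one and the same probability space $(\Omega,\mathcal F,\mathbb P)$ for all $x,x'$, with $$\mathbb P\big(d(\mathcal R(x,x'),\mathcal R'(x,x'))>r\,d(x,x')\big)\le g(d(x,x')),$$ where $g:[0,\infty)\to[0,\infty)$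 is a continuous increasing function with $g(0)=0$ and $\limsup_{n\to\infty}\frac1n\ln g(r^n)<0$, and the maps $\mathcal R,\mathcal R':\mathcal Y_\infty\times\mathcal Y_\infty\times\Omega\to\mathcal X$ are measurable. Then the Markov process $\{x_n\}$ has a unique invariant measure $\mu_*\in\mathcal P(\mathcal X)$, and $\mu_*$ has compact support. Moreover, there exist constants $C,\beta>0$ such that $$\|P_n^*\nu-\mu_*\|_L^*\le Ce^{-\beta n}\Big(1+\int_{\mathcal X}V(x)\,\nu(dx)\Big)$$ for every $\nu\in\mathcal P(\mathcal X)$ with $\int_{\mathcal X}V\,d\nu<\infty$ and every $n\in\mathbb N$.
   Context: $\mathbb N=\{0,1,2,\dots\}$. For $\boldsymbol\zeta=(\zeta_n)_{n\in\mathbb N}\in\mathcal Z^{\mathbb N}$ and $x\in\mathcal X$, $S_n(x;\boldsymbol\zeta)=S_n(x;\zeta_0,\dots,\zeta_{n-1})$ is the $n$-th element of the deterministic sequence $y_0=x$, $y_{k+1}=S(y_k,\zeta_k)$. $B(z,\varepsilon)$ is the open ball in $\mathcal X$, and $\operatorname{dist}(x,A)=\inf_{y\in A}d(x,y)$. Attainable sets: for $\mathcal Y\subset\mathcal X$, $\mathcal Y_0=\mathcal Y$, $\mathcal Y_n=\{S_n(x;\zeta_0,\dots,\zeta_{n-1}):x\in\mathcal Y,\ \zeta_0,\dots,\zeta_{n-1}\in\mathcal E\}$ for $n\ge1$, and $\mathcal Y_\infty=\overline{\bigcup_{n\in\mathbb N}\mathcal Y_n}$. $\mathcal P(\mathcal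 X)$ is the set of Borel probability measures on $\mathcal X$; $P_n(x,A)=\mathbb P_x(x_n\in A)$; $P_n^*\mu(A)=\int_{\mathcal X}P_n(x,A)\,\mu(dx)$; $\mu$ is invariant if $P_n^*\mu=\mu$ for all $n$. A coupling of $\mu_1,\mu_2\in\mathcal P(\mathcal X)$ is a pair of $\mathcal X$-valued random variables on a common probability space with laws $\mu_1$ and $\mu_2$. The dual-Lipschitz distance is $\|\mu-\nu\|_L^*=\sup\{|\int f\,d\mu-\int f\,d\nu|:\ \|f\|_L\le1\}$, where for bounded Lipschitz $f:\mathcal X\to\mathbb R$, $\|f\|_L=\sup|f|+\sup_{x\ne y}\frac{|f(x)-f(y)|}{d(x,y)}$. Convention: $\ln 0=-\infty$. *)

(* Defs.v *)
From HB Require Import structures.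
From mathcomp Require Import all_boot all_order all_algebra.
From mathcomp Require Import all_classical all_reals all_analysis.

Set Implicit Arguments.
Unset Strict Implicit.
Unset Printing Implicit Defensive.

Import Order.TTheory GRing.Theory Num.Theory.
Import numFieldNormedType.Exports.

Local Open Scope classical_set_scope.
Local Open Scope ring_scope.

HB.mixin Record isSeparable T & Topological T := {
  separable_space : exists2 D : set T, countable D & dense D
}.

(* A Polish space with its distinguished metric [mdist], which is complete.
   [Complete] includes a base point, so only the empty space is left out. *)
#[short(type="polishType")]
HB.structure Definition Polish (R : realType) :=
  {T of Metric R T & Complete T & isSeparable T}.

Notation borel T := (g_sigma_algebraType (@open T)).

Section metric_notions.
Context {R : realType}.

(* On a product, [ball] is the ball of the max metric. *)
Definition mbounded (T : pseudoMetricType R) (A : set T) : Prop :=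
  exists (x : T) (M : R), A `<=` ball x M.

Definition locally_lipschitz (X Z : metricType R) (S : X -> Z -> X) : Prop :=
  forall D : set (X * Z), mbounded D ->
  exists L : R, forall p q : X * Z, D p -> D q ->
    mdist (S p.1 p.2) (S q.1 q.2)
      <= L * Num.max (mdist p.1 q.1) (mdist p.2 q.2).

Definition dist_to (X : metricType R) (x : X) (A : set X) : \bar R :=
  ereal_inf [set (mdist x y)%:E | y in A].

Local Open Scope ereal_scope.

(* The [maxe 0] only matters when X is a single point: [ereal_sup set0] is
   [-oo]. *)
Definition lip_const (X : metricType R) (f : X -> R) : \bar R :=
  maxe 0 (ereal_sup [set (`|f p.1 - f p.2| / mdist p.1 p.2)%R%:E
                    | p in [set p : X * X | p.1 != p.2]]).

Definition lip_norm (X : metricType R) (f : X -> R) : \bar R :=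
  ereal_sup [set `|f x|%R%:E | x in [set: X]] + lip_const f.

(* Stated for set functions because [dual_transition S xi n nu] below is not
   packaged as a measure; [integral] does not require one. *)
Definition dual_lip (X : polishType R) (mu nu : set (borel X) -> \bar R)
    : \bar R :=
  ereal_sup
    [set `| \int[mu]_x (f x)%:E - \int[nu]_x (f x)%:E |
    | f in [set f : X -> R | lip_norm f <= 1]].

Definition measure_support (X : topologicalType) (mu : set X -> \bar R) : set X :=
  [set x | forall U : set X, open U -> U x -> 0 < mu U].

End metric_notions.

Section probability_notions.
Context {R : realType} {d d' : measure_display}.
Context {Omega : measurableType d} {T : measurableType d'}.
Variable P : probability Omega R.

Local Open Scope ereal_scope.

Definition mutually_independent (xi : nat -> {RV P >-> T}) : Prop :=
  forall (J : seq nat) (A : nat -> set T), uniq J ->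
    (forall j, measurable (A j)) ->
    P (\bigcap_(j in [set` J]) (xi j @^-1` A j))
      = \prod_(j <- J) P (xi j @^-1` A j).

Definition has_law (f : Omega -> T) (mu : set T -> \bar R) : Prop :=
  measurable_fun [set: Omega] f /\
  forall A, measurable A -> pushforward P f A = mu A.

Definition iid (xi : nat -> {RV P >-> T}) (l : probability T R) : Prop :=
  mutually_independent xi /\ forall n, has_law (xi n) l.

Definition coupling (f f' : Omega -> T) (mu mu' : set T -> \bar R) : Prop :=
  has_law f mu /\ has_law f' mu'.

End probability_notions.

Section iterations.
Context {X Z : Type}.
Variable S : X -> Z -> X.

Fixpoint iterS (n : nat) (x : X) (zeta : nat -> Z) : X :=
  if n is k.+1 then S (iterS k x zeta) (zeta k) else x.

End iterations.

Section attainable_sets.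
Context {X : topologicalType} {Z : Type}.
Variables (S : X -> Z -> X) (E : set Z) (Y : set X).

Definition attainable (n : nat) : set X :=
  [set iterS S n x zeta
  | x in Y & zeta in [set zeta : nat -> Z | forall k, (k < n)%N -> E (zeta k)]].

Definition attainable_infty : set X := closure (\bigcup_n attainable n).

End attainable_sets.

Section markov_process.
Context {R : realType} {X Z : polishType R} {d : measure_display}.
Context {Omega : measurableType d} {P : probability Omega R}.
Variables (S : X -> Z -> X) (xi : nat -> {RV P >-> borel Z}).

Local Open Scope ereal_scope.

Definition process (x : X) (n : nat) (w : Omega) : X :=
  iterS S n x (fun k => xi k w).

Definition transition (n : nat) (x : X) (A : set (borel X)) : \bar R :=
  P (process x n @^-1` A).

Definition dual_transition (n : nat) (mu : probability (borel X) R)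
    (A : set (borel X)) : \bar R :=
  \int[mu]_x transition n x A.

Definition invariant_measure (mu : probability (borel X) R) : Prop :=
  forall n (A : set (borel X)), measurable A -> dual_transition n mu A = mu A.

Definition asymptotic_compactness (E : set Z) (Y : set X) (V : X -> R)
    : Prop :=
  [/\ compact Y,
      measurable_fun [set: borel X] (V : borel X -> R),
      (forall x, 0 <= V x)%R,
      (forall A : set X, mbounded A ->
         exists M : R, forall x, A x -> (V x <= M)%R) &
      exists2 kappa : R, (0 < kappa)%R &
        forall (x : X) (zeta : nat -> Z) (n : nat),
          (forall k, E (zeta k)) -> (1 <= n)%N ->
          dist_to (iterS S n x zeta) Y <= (V x * expR (- kappa * n%:R))%:E].

Definition irreducibility (E : set Z) (Y : set X) : Prop :=
  exists2 z : X, Y z &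
    forall eps : R, (0 < eps)%R ->
    exists2 m : nat, (1 <= m)%N &
      0 < ereal_inf [set transition m x (ball z eps)
                    | x in attainable_infty S E Y].

(* Conditions on [0, +oo[ only; [lne 0 = -oo], and the term [n = 0] is
   irrelevant to the limsup. *)
Definition admissible_rate (r : R) (g : R -> R) : Prop :=
  [/\ (forall t, 0 <= t -> 0 <= g t)%R,
      {within [set t : R | (0 <= t)%R], continuous g},
      (forall s t, 0 <= s -> s <= t -> g s <= g t)%R,
      g 0%R = 0%R &
      limn_esup (fun n : nat => (n%:R^-1)%:E * lne (g (r ^+ n)%R)%:E) < 0].

Definition coupling_hypothesis (E : set Z) (Y : set X) : Prop :=
  let Yoo : set (borel X) := attainable_infty S E Y in
  exists (r : R) (g : R -> R),
  [/\ (0 <= r)%R, (r < 1)%R, admissible_rate r g &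
  exists (d' : measure_display) (Omega' : measurableType d')
      (P' : probability Omega' R) (f f' : X -> X -> Omega' -> X),
    [/\ measurable_fun ((Yoo `*` Yoo) `*` [set: Omega'])
          (fun p : borel X * borel X * Omega' =>
             f p.1.1 p.1.2 p.2 : borel X),
        measurable_fun ((Yoo `*` Yoo) `*` [set: Omega'])
          (fun p : borel X * borel X * Omega' =>
             f' p.1.1 p.1.2 p.2 : borel X) &
        forall x x' : X, Yoo x -> Yoo x' ->
          coupling P' (f x x' : Omega' -> borel X) (f' x x')
            (transition 1 x) (transition 1 x') /\
          P' [set w | (r * mdist x x' < mdist (f x x' w) (f' x x' w))%R]
            <= (g (mdist x x'))%:E]].

End markov_process.

(* Main.v *)
(* Everything is proved by duality, for the operator [T f x = E f (S x xi_0)];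
   couplings are never composed. On the compact invariant set [K] (the closure of
   the attainable sets) measure the oscillation of [f] against the cost
   [rho = min 1 (phi d)], where [phi] is chosen so that
   [phi (r t) + g t <= q phi t] for some [q < 1] whenever [phi t < 1]. Since
   [T f x - T f x'] is the mean of [f R - f R'] for the coupling of [P_1 x] and
   [P_1 x'], the operator [T] does not increase the [rho]-Lipschitz constant on
   [K] and contracts it at points with [rho < 1]. At the other points
   irreducibility lets [T^m] reduce the oscillation. Hence [T^n f] becomes
   constant on [K] exponentially fast.
   A stationary measure is obtained by representing the ultralimit of
   [f |-> T^n f x0] as an integral (Riesz representation on a compact set).
   From an arbitrary [x], run [k] steps to come exponentially close to [Y], then
   [j] steps along the same noise as a point of [Y]: local Lipschitz continuity
   costs a factor [L^j], which the closeness absorbs if [j] is a small fraction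
   of [k]. *)
Require Import Defs.
From HB Require Import structures.
From mathcomp Require Import all_boot all_order all_algebra.
From mathcomp Require Import all_classical all_reals all_analysis.
From mathcomp Require Import measurable_realfun ring lra.

Set Implicit Arguments.
Unset Strict Implicit.
Unset Printing Implicit Defensive.

Import Order.TTheory GRing.Theory Num.Theory.
Import numFieldNormedType.Exports.

Local Open Scope classical_set_scope.
Local Open Scope ring_scope.

(** * Means of bounded measurable functions *)

(** Truncating the cost at 1 puts a price on a failed coupling: two points of [K] never cost more
    than 1, so failure contributes at most its probability, and [phi (r t) + g t] is the quantity to
    control. Where [phi t >= 1] the cost is saturated and a coupling step promises no gain;
    irreducibility has to act exactly there. Test functions live on all of [X], while the estimates
    hold only on [K] and for noise in the support of [l]; hence means are compared throughout under
    inequalities valid on a set of full measure. Everything ends in one pointwise bound of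
    [T^n f x - \int f dmu] by a multiple of [exp (- beta n) (1 + V x)]. Integrated, it is the
    announced rate; through dominated convergence it gives uniqueness among all invariant measures,
    whether or not they integrate [V]. *)

Section bounded_measurable.
Context {d : measure_display} {T : measurableType d} {R : realType}.
Implicit Types f g : T -> R.

Definition bounded_measurable f :=
  measurable_fun [set: T] f /\ exists M, forall x, `|f x| <= M.

Lemma bounded_measurable_cst c : bounded_measurable (cst c).
Proof. by split=> //; exists `|c|. Qed.

Lemma bounded_measurableD f g : bounded_measurable f -> bounded_measurable g ->
  bounded_measurable (fun x => f x + g x).
Proof.
move=> [mf [M fM]] [mg [N gN]]; split; first exact: measurable_funD.
by exists (M + N) => x; rewrite (le_trans (ler_normD _ _))// lerD.
Qed.

Lemma bounded_measurableM f g : bounded_measurable f -> bounded_measurable g ->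
  bounded_measurable (fun x => f x * g x).
Proof.
move=> [mf [M fM]] [mg [N gN]]; split; first exact: measurable_funM.
by exists (M * N) => x; rewrite normrM ler_pM.
Qed.

Lemma bounded_measurableZ c f : bounded_measurable f ->
  bounded_measurable (fun x => c * f x).
Proof. by move=> ?; apply: bounded_measurableM => //; exact: bounded_measurable_cst. Qed.

Lemma bounded_measurableN f : bounded_measurable f ->
  bounded_measurable (fun x => - f x).
Proof.
by move=> /(bounded_measurableZ (-1)); under eq_fun do rewrite mulN1r.
Qed.

Lemma bounded_measurableB f g : bounded_measurable f -> bounded_measurable g ->
  bounded_measurable (fun x => f x - g x).
Proof. by move=> ? /bounded_measurableN; exact: bounded_measurableD. Qed.

Lemma bounded_measurable_norm f : bounded_measurable f ->
  bounded_measurable (fun x => `|f x|).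
Proof.
move=> [mf [M fM]]; split; first exact: measurableT_comp.
by exists M => x; rewrite normr_id.
Qed.

Lemma bounded_measurable_indic (A : set T) : measurable A ->
  bounded_measurable (\1_A : T -> R).
Proof.
move=> mA; split; first exact: measurable_indic.
by exists 1 => x; rewrite indicE; case: (_ \in _); rewrite ?normr1 ?normr0.
Qed.

Variable mu : probability T R.

Lemma bounded_measurable_integrable f : bounded_measurable f ->
  mu.-integrable [set: T] (EFin \o f).
Proof.
move=> [mf [M fM]]; apply: measurable_bounded_integrable => //.
  by rewrite (le_lt_trans (probability_le1 _ _)) ?ltry.
exists M; split; first exact: num_real.
by move=> N MN x _; rewrite /= (le_trans (fM x))// ltW.
Qed.

Lemma mean_cst c : \int[mu]_x c = c.
Proof. by rewrite Rintegral_cst//= probability_setT mulr1. Qed.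

Lemma meanD f g : bounded_measurable f -> bounded_measurable g ->
  \int[mu]_x (f x + g x) = \int[mu]_x f x + \int[mu]_x g x.
Proof.
by move=> bf bg; rewrite RintegralD//; exact: bounded_measurable_integrable.
Qed.

Lemma meanB f g : bounded_measurable f -> bounded_measurable g ->
  \int[mu]_x (f x - g x) = \int[mu]_x f x - \int[mu]_x g x.
Proof.
by move=> bf bg; rewrite RintegralB//; exact: bounded_measurable_integrable.
Qed.

Lemma meanZ c f : bounded_measurable f ->
  \int[mu]_x (c * f x) = c * \int[mu]_x f x.
Proof.
by move=> bf; rewrite RintegralZl//; exact: bounded_measurable_integrable.
Qed.

Lemma EFin_mean f : bounded_measurable f ->
  (\int[mu]_x f x)%:E = (\int[mu]_x (f x)%:E)%E.
Proof.
move=> /bounded_measurable_integrable/(integrable_fin_num measurableT).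
by rewrite /Rintegral => /fineK.
Qed.

Lemma mean_indic (A : set T) : measurable A ->
  (\int[mu]_x (\1_A x : R))%:E = mu A.
Proof.
move=> mA; rewrite EFin_mean; last exact: bounded_measurable_indic.
by rewrite integral_indic// setIT.
Qed.

Lemma mean_indicC1 (A : set T) : measurable A -> mu A = 1%E ->
  \int[mu]_x (\1_(~` A) x : R) = 0.
Proof.
move=> mA muA; have mCA : measurable (~` A) by exact: measurableC.
apply: EFin_inj; rewrite mean_indic//.
by rewrite probability_setC// muA subee.
Qed.

(** Adding to [g] the multiple [M + N] of the indicator of the complement of [A] makes the
    inequality hold everywhere and leaves the mean of [g] unchanged. *)
Lemma le_mean_full (A : set T) f g :
  measurable A -> mu A = 1%E -> bounded_measurable f -> bounded_measurable g ->
  (forall x, A x -> f x <= g x) -> \int[mu]_x f x <= \int[mu]_x g x.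
Proof.
move=> mA muA bf bg fg; have [_ [M fM]] := bf; have [_ [N gN]] := bg.
have bCA := bounded_measurable_indic (measurableC mA).
have -> : \int[mu]_x g x = \int[mu]_x (g x + (M + N) * \1_(~` A) x).
  by rewrite meanD ?meanZ// ?mean_indicC1 ?mulr0 ?addr0//;
    exact: bounded_measurableZ.
apply: le_Rintegral => //.
- exact: bounded_measurable_integrable.
- by apply: bounded_measurable_integrable; apply: bounded_measurableD => //;
    exact: bounded_measurableZ.
move=> x _; rewrite indicE; have [/set_mem|/negP nA] := boolP (x \in ~` A).
  move=> _; rewrite mulr1.
  have := fM x; have := gN x; rewrite !ler_norml; lra.
by rewrite mulr0 addr0 fg//; apply: contrapT => nAx; apply: nA; exact: mem_set.
Qed.

Lemma le_mean f g : bounded_measurable f -> bounded_measurable g ->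
  (forall x, f x <= g x) -> \int[mu]_x f x <= \int[mu]_x g x.
Proof.
move=> bf bg fg; apply: (@le_mean_full setT) => //.
exact: probability_setT.
Qed.

Lemma dist_mean_full (A : set T) f c M :
  measurable A -> mu A = 1%E -> bounded_measurable f ->
  (forall x, A x -> `|f x - c| <= M) -> `|\int[mu]_x f x - c| <= M.
Proof.
move=> mA muA bf fc.
have lo : c - M <= \int[mu]_x f x.
  rewrite -[X in X <= _]mean_cst.
  apply: (le_mean_full mA muA) => //; first exact: bounded_measurable_cst.
  by move=> x /fc; rewrite ler_norml /=; lra.
have hi : \int[mu]_x f x <= c + M.
  rewrite -[X in _ <= X]mean_cst.
  apply: (le_mean_full mA muA) => //; first exact: bounded_measurable_cst.
  by move=> x /fc; rewrite ler_norml /=; lra.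
by rewrite ler_norml; lra.
Qed.

Lemma dist_mean2_full (A : set T) f g M :
  measurable A -> mu A = 1%E -> bounded_measurable f -> bounded_measurable g ->
  (forall x, A x -> `|f x - g x| <= M) ->
  `|\int[mu]_x f x - \int[mu]_x g x| <= M.
Proof.
move=> mA muA bf bg fg; rewrite -meanB// -[X in `|X|]subr0.
apply: (dist_mean_full mA) => //; first exact: bounded_measurableB.
by move=> x /fg; rewrite subr0.
Qed.

Lemma norm_mean_le f M : bounded_measurable f ->
  (forall x, `|f x| <= M) -> `|\int[mu]_x f x| <= M.
Proof.
move=> bf fM; rewrite -[X in `|X|]subr0.
apply: (dist_mean_full measurableT) => //; first exact: probability_setT.
by move=> x _; rewrite subr0.
Qed.

End bounded_measurable.

Lemma bounded_measurable_comp {d1 d2 : measure_display} {T1 : measurableType d1}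
    {T2 : measurableType d2} {R : realType} (f : T2 -> R) (phi : T1 -> T2) :
  measurable_fun [set: T1] phi -> bounded_measurable f ->
  bounded_measurable (f \o phi).
Proof.
move=> mphi [mf [M fM]]; split; first exact: measurableT_comp.
by exists M => x /=.
Qed.

Section image_probability.
Context {d1 d2 : measure_display} {T1 : measurableType d1}
  {T2 : measurableType d2} {R : realType}.
Variable mu : probability T1 R.

Definition image_probability (phi : T1 -> T2)
    (mphi : measurable_fun [set: T1] phi) : probability T2 R :=
  distribution mu (mfun_Sub (mem_set mphi)).

Variables (phi : T1 -> T2) (mphi : measurable_fun [set: T1] phi).

Lemma integral_image_probability (f : T2 -> R) : bounded_measurable f ->
  (\int[image_probability mphi]_x (f x)%:E = \int[mu]_x (f (phi x))%:E)%E.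
Proof.
move=> bf; rewrite integral_distribution//.
- by case: bf => mf _; exact/measurable_EFinP.
- apply: bounded_measurable_integrable => //; exact: bounded_measurable_comp.
Qed.

Lemma mean_image_probability (f : T2 -> R) : bounded_measurable f ->
  \int[image_probability mphi]_x f x = \int[mu]_x f (phi x).
Proof. by move=> bf; rewrite /Rintegral integral_image_probability. Qed.

End image_probability.

Lemma eq_measure_mean {d : measure_display} {T : measurableType d}
    {R : realType} (mu nu : probability T R) (f : T -> R) :
  (forall A, measurable A -> mu A = nu A) ->
  \int[mu]_x f x = \int[nu]_x f x.
Proof.
by move=> munu; congr fine; apply: eq_measure_integral => A mA _; exact: munu.
Qed.

Section fubini_bounded.
Context {d1 d2 : measure_display} {T1 : measurableType d1}
  {T2 : measurableType d2} {R : realType}.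
Variables (m1 : probability T1 R) (m2 : probability T2 R).
Variable f : T1 * T2 -> R.
Hypothesis bf : bounded_measurable f.

Lemma bounded_measurable_section x : bounded_measurable (fun y => f (x, y)).
Proof.
case: bf => mf [M fM]; split; last by exists M.
exact: (measurable_comp measurableT _ mf (pair1_measurable x)).
Qed.

Local Notation m12 := ((m1 \x m2)%E : probability (T1 * T2)%type R).

Lemma bounded_measurable_partial :
  bounded_measurable (fun x => \int[m2]_y f (x, y)).
Proof.
have [mf [M fM]] := bf; split; last first.
  exists M => x; apply: norm_mean_le => //.
  exact: bounded_measurable_section.
(* Fubini yields the measurability of the partial integral once the first factor carries some
   measure; a Dirac mass serves, so the lemma is about [m2] alone. *)
have /(bounded_measurable_integrable (\d_point \x m2)%E)/measurable_fubini_F mF := bf.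
exact: (measurableT_comp (fine_measurable measurableT) mF).
Qed.

Lemma mean_fubini :
  \int[m12]_z f z = \int[m1]_x \int[m2]_y f (x, y).
Proof.
apply: EFin_inj; rewrite !EFin_mean//; last first.
  exact: bounded_measurable_partial.
rewrite -integral12_prod_meas1; last exact: (bounded_measurable_integrable m12).
apply: eq_integral => x _.
by rewrite EFin_mean//; exact: bounded_measurable_section.
Qed.

End fubini_bounded.

(** * Borel sets of Polish spaces *)

Section polish_measurability.
Context {R : realType}.

Lemma dense_sequence (X : polishType R) :
  exists e : nat -> X, forall x eps, 0 < eps -> exists n, ball x eps (e n).
Proof.
have [D cD dD] := @separable_space R X.
have [D0|[e]] := pfcard_geP cD.
  have [] := dD setT; [by exists point|exact: openT|].
  by rewrite D0 setI0 => y [].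
exists e => x eps eps0.
have [] := dD ((ball x eps)^°).
- by exists x; apply: nbhsx_ballx.
- exact: open_interior.
move=> y [/interior_subset xy Dy].
by have [n _ en] := @surj _ _ _ _ e y Dy; exists n; rewrite en.
Qed.

Lemma metric_openP (X : metricType R) (U : set X) :
  open U <-> forall x, U x -> exists2 eps, 0 < eps & ball x eps `<=` U.
Proof.
rewrite openE; split=> h x Ux.
  by have /nbhs_ballP[eps eps0 xU] := h x Ux; exists eps.
by have [eps eps0 xU] := h x Ux; apply/nbhs_ballP; exists eps.
Qed.

Lemma open_ball (X : metricType R) (x : X) (eps : R) : open (ball x eps).
Proof.
apply/metric_openP => y; rewrite ballEmdist/= => xy.
exists (eps - mdist x y); first by rewrite subr_gt0.
move=> z; rewrite !ballEmdist/= => yz.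
by have := metric_triangle x y z; lra.
Qed.

Lemma small_invS (eps : R) : 0 < eps -> exists k : nat, k.+1%:R^-1 < eps.
Proof.
move=> eps0; have [k _ /(_ k (leqnn _))/= kP] := near_infty_natSinv_lt (PosNum eps0).
by exists k.
Qed.

Lemma polish_basis (X : polishType R) :
  exists e : nat -> X, forall (x : X) eps, 0 < eps ->
    exists n k : nat, ball (e n) k.+1%:R^-1 x /\
      ball (e n) k.+1%:R^-1 `<=` ball x eps.
Proof.
have [e eP] := dense_sequence X; exists e => x eps eps0.
have [k keps] : exists k : nat, k.+1%:R^-1 < eps / 2.
  by apply: small_invS; rewrite divr_gt0.
have [n xn] := eP x k.+1%:R^-1 ltac:(by []).
exists n, k; split; first exact: ball_sym.
move=> y ny; have := ball_triangle xn ny; apply: le_ball.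
by rewrite (splitr eps) lerD// ltW.
Qed.

Lemma borel_open (X : polishType R) (U : set X) : open U ->
  measurable (U : set (borel X)).
Proof. by move=> oU; exact: sub_sigma_algebra. Qed.

Lemma borel_closed (X : polishType R) (F : set X) : closed F ->
  measurable (F : set (borel X)).
Proof.
by rewrite -openC => /borel_open/measurableC; rewrite setCK.
Qed.

(** Separability is used here: [U] is the union of the basic rectangles it contains, and there are
    only countably many. This makes continuous maps on [X * Z] measurable for the product of the two
    Borel sigma-algebras. *)
Lemma measurable_open_prod (X Z : polishType R) (U : set (X * Z)) : open U ->
  measurable (U : set (borel X * borel Z)).
Proof.
have [e eP] := polish_basis X; have [f fP] := polish_basis Z => oU.
pose B i : set X := ball (e i.1) i.2.+1%:R^-1.
pose C i : set Z := ball (f i.1) i.2.+1%:R^-1.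
pose F (i : (nat * nat) * (nat * nat)) : set (borel X * borel Z) :=
  if `[< B i.1 `*` C i.2 `<=` U >] then B i.1 `*` C i.2 else set0.
have -> : U = \bigcup_i F i.
  apply/seteqP; split=> [[x z] Uxz|p [i _]]; last first.
    by rewrite /F; case: asboolP => // h; exact: h.
  move: oU; rewrite openE => /(_ _ Uxz)/nbhs_ballP[eps eps0 xzU].
  have [n [k [xB Bsub]]] := eP x eps eps0.
  have [n' [k' [zC Csub]]] := fP z eps eps0.
  exists ((n, k), (n', k')) => //; rewrite /F; case: asboolP => [_|[]]; first by split.
  move=> [y w] [/= By Cw]; apply: xzU; split; [exact: Bsub|exact: Csub].
apply: countable_bigcupT_measurable => //.
move=> i; rewrite /F; case: asboolP => // _.
by apply: measurableX; apply: borel_open; exact: open_ball.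
Qed.

Lemma continuous_measurable_prod (X Z : polishType R) (T : ptopologicalType)
    (f : X * Z -> T) : continuous f ->
  measurable_fun [set: borel X * borel Z] (f : borel X * borel Z -> borel T).
Proof.
move=> /continuousP cf; apply:
  (@measurability _ _ (borel X * borel Z)%type (borel T) setT f (@open T)) => //.
by move=> _ [B oB <-]; rewrite setTI; apply: measurable_open_prod; exact: cf.
Qed.

Lemma continuous_measurable_prod_real (X Z : polishType R) (f : X * Z -> R) :
  continuous f -> measurable_fun [set: borel X * borel Z] f.
Proof.
move=> /continuousP cf.
apply: (measurability _ (RGenOpens.measurableE R)).
move=> _ [_ [a [b ->] <-]]; rewrite setTI; apply: measurable_open_prod.
by apply: cf; exact: interval_open.
Qed.

Lemma continuous_borel_measurable (X : polishType R) (f : X -> R) :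
  continuous f -> measurable_fun [set: borel X] (f : borel X -> R).
Proof.
move=> /continuousP cf.
apply: (measurability _ (RGenOpens.measurableE R)).
move=> _ [_ [a [b ->] <-]]; rewrite setTI; apply: borel_open.
by apply: cf; exact: interval_open.
Qed.

Lemma mdist_continuous (X : metricType R) :
  continuous (fun p : X * X => mdist p.1 p.2).
Proof.
move=> [x y]; apply/cvgrPdist_lt => eps eps0.
have eps2 : 0 < eps / 2 by rewrite divr_gt0.
have := nbhsx_ballx (x, y) (eps / 2) eps2.
apply: filterS => -[x' y'] [/=]; rewrite !ballEmdist/= => xx' yy'.
have h1 := metric_triangle x x' y; have h2 := metric_triangle x' y' y.
have h3 := metric_triangle x' x y'; have h4 := metric_triangle x y y'.
rewrite (metric_sym y' y) in h2; rewrite (metric_sym x' x) in h3.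
by rewrite ltr_norml; lra.
Qed.

Lemma closed_support (X : topologicalType) (mu : set X -> \bar R) :
  closed (measure_support mu).
Proof.
move=> x clx U oU Ux.
by have [y [sy Uy]] := clx U (open_nbhs_nbhs (conj oU Ux)); exact: sy.
Qed.

(** A point off the support has a null neighbourhood, hence lies in a null ball of the countable
    base; these balls cover the complement of the support. *)
Lemma support_full (Z : polishType R) (l : probability (borel Z) R) :
  l (measure_support (l : set Z -> \bar R)) = 1%E.
Proof.
have mE : measurable (measure_support (l : set Z -> \bar R) : set (borel Z)).
  by apply: (@borel_closed Z); exact: closed_support.
set E := measure_support _ in mE *.
suff /negligibleP l0 : l.-negligible (~` E).
  by rewrite -(setCK E) probability_setC ?l0 ?sube0//; exact: measurableC.
have [e eP] := polish_basis Z.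
pose F n k : set (borel Z) :=
  if `[< l (ball (e n) k.+1%:R^-1) = 0%E >] then ball (e n) k.+1%:R^-1 else set0.
apply: (@negligibleS _ (borel Z) R l (\bigcup_n \bigcup_k F n k)); last first.
  apply: negligible_bigcup => n; apply: negligible_bigcup => k.
  rewrite /F; case: asboolP => [h|_]; last exact: negligible_set0.
  by apply/negligibleP => //; apply: (@borel_open Z); exact: open_ball.
move=> z /existsNP[U /not_implyP[oU /not_implyP[Uz /negP lU]]].
have [eps eps0 zU] := (metric_openP U).1 oU z Uz.
have [n [k [zb bz]]] := eP z eps eps0.
exists n => //; exists k => //; rewrite /F; case: asboolP => [//|[]].
apply/eqP; rewrite eq_le measure_ge0 andbT.
rewrite -leNgt in lU; apply: le_trans lU.
apply: le_measure; rewrite ?inE//; [|exact: (@borel_open Z)|exact: subset_trans zU].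
by apply: (@borel_open Z); exact: open_ball.
Qed.

End polish_measurability.

(** * The Markov operator of the random iteration *)

Lemma eq_measure_rectangles {d1 d2 : measure_display} {T1 : measurableType d1}
    {T2 : measurableType d2} {R : realType}
    (m1 m2 : {measure set (T1 * T2) -> \bar R}) :
  (m1 setT < +oo)%E ->
  (forall A B, measurable A -> measurable B -> m1 (A `*` B) = m2 (A `*` B)) ->
  forall D, measurable D -> m1 D = m2 D.
Proof.
move=> m1oo m12 D mD.
pose G : set (set (T1 * T2)) :=
  [set A `*` B | A in measurable & B in measurable].
apply: (measure_unique G (fun=> setT)) => //.
- by rewrite measurable_prod_measurableType.
- move=> _ _ [A1 mA1 [B1 mB1 <-]] [A2 mA2 [B2 mB2 <-]].
  exists (A1 `&` A2); first exact: measurableI.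
  by exists (B1 `&` B2); [exact: measurableI|rewrite setXI].
- by move=> _; exists setT => //; exists setT => //; rewrite setXTT.
- by rewrite bigcup_const//; exists 0%N.
- by move=> _ [A mA [B mB <-]]; exact: m12.
Qed.

Section markov_operator.
Context {R : realType} {X Z : polishType R} (S : X -> Z -> X).
Variable l : probability (borel Z) R.
Hypothesis cS : continuous (fun p : X * Z => S p.1 p.2).

Implicit Types f : borel X -> R.

Definition markov_op (f : borel X -> R) (x : borel X) : R :=
  \int[l]_z f (S x z).

Lemma measurable_step : measurable_fun [set: borel X * borel Z]
  (fun p : borel X * borel Z => S p.1 p.2 : borel X).
Proof. exact: (continuous_measurable_prod cS). Qed.

Lemma bounded_measurable_step f x : bounded_measurable f ->
  bounded_measurable (fun z : borel Z => f (S x z)).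
Proof.
move=> /(bounded_measurable_comp measurable_step) bf.
exact: (bounded_measurable_section bf x).
Qed.

Lemma bounded_measurable_markov_op f : bounded_measurable f ->
  bounded_measurable (markov_op f).
Proof.
move=> /(bounded_measurable_comp measurable_step) bf.
exact: (bounded_measurable_partial l bf).
Qed.

Lemma bounded_measurable_iter_markov_op n f : bounded_measurable f ->
  bounded_measurable (iter n markov_op f).
Proof. by move=> bf; elim: n => //= n; exact: bounded_measurable_markov_op. Qed.

Lemma norm_iter_markov_op_le n f M : bounded_measurable f ->
  (forall x, `|f x| <= M) -> forall x, `|iter n markov_op f x| <= M.
Proof.
move=> bf fM; elim: n => //= n IH x; apply: norm_mean_le => //.
by apply: bounded_measurable_step; exact: bounded_measurable_iter_markov_op.
Qed.

Section process.
Context {d : measure_display} {Omega : measurableType d}.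
Variables (P : probability Omega R) (xi : nat -> {RV P >-> borel Z}).
Hypothesis xi_iid : iid xi l.

Lemma measurable_process2 n : measurable_fun [set: borel X * Omega]
  (fun p : borel X * Omega => process S xi p.1 n p.2 : borel X).
Proof.
elim: n => [|n IH]; first exact: measurable_fst.
have mxi : measurable_fun [set: borel X * Omega]
    (fun p : borel X * Omega => xi n p.2).
  exact: (measurableT_comp _ measurable_snd).
exact: (measurableT_comp measurable_step (measurable_fun_pair IH mxi)).
Qed.

Lemma measurable_process x n :
  measurable_fun [set: Omega] (process S xi x n : Omega -> borel X).
Proof.
exact: (measurable_fun_pair2 (x : borel X) (measurable_process2 n)).
Qed.

Let cylinder (J : seq nat) (B : nat -> set (borel Z)) : set Omega :=
  \bigcap_(j in [set` J]) (xi j @^-1` B j).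

Let measurable_cylinder J B : (forall j, measurable (B j)) ->
  measurable (cylinder J B).
Proof.
move=> mB; rewrite /cylinder; apply: fin_bigcap_measurable => // j _.
by rewrite -[X in measurable X]setTI; exact: measurable_funP.
Qed.

(* The induction needs events on all the noises from time [n] on, not just on
   [xi n]. *)
Lemma process_independent n x J (B : nat -> set (borel Z)) (A : set (borel X)) :
  uniq J -> all (leq n) J -> (forall j, measurable (B j)) -> measurable A ->
  P (process S xi x n @^-1` A `&` cylinder J B) =
  (P (process S xi x n @^-1` A) * P (cylinder J B))%E.
Proof.
have [xi_ind _] := xi_iid.
have mpre (phi : Omega -> borel X) C : measurable_fun setT phi -> measurable C ->
    measurable (phi @^-1` C).
  by move=> mphi mC; rewrite -[X in measurable X]setTI; exact: mphi.
elim: n J B A => [|n IH] J B A uJ nJ mB mA.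
  have [Ax|nAx] := pselect (A x).
    have -> : process S xi x 0 @^-1` A = setT by apply/seteqP; split.
    by rewrite setTI probability_setT mul1e.
  have -> : process S xi x 0 @^-1` A = set0 by apply/seteqP; split.
  by rewrite set0I measure0 mul0e.
pose phi w : borel X * borel Z := (process S xi x n w : borel X, xi n w).
have mphi : measurable_fun setT phi.
  exact: (measurable_fun_pair (measurable_process x n)).
have mC := @measurable_cylinder J B mB.
have PC : P (cylinder J B) \is a fin_num by exact: fin_num_measure.
have PC0 : 0 <= fine (P (cylinder J B)) by apply: fine_ge0.
(* With the cylinder fixed, both sides are finite measures of an event on the pair (position, noise)
   at time [n], so rectangles suffice. On a rectangle, [B1] inserts the event on [xi n] into the
   cylinder, and the induction hypothesis applies to the lists [n :: J] and [[:: n]]. *)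
have [m1 m1E] : exists m : {measure set (borel X * borel Z) -> \bar R},
    forall D, m D = P (phi @^-1` D `&` cylinder J B).
  unshelve eexists; first exact: (pushforward (mrestr P mC) phi).
  by [].
have [m2 m2E] : exists m : {measure set (borel X * borel Z) -> \bar R},
    forall D, m D = (P (cylinder J B) * P (phi @^-1` D))%E.
  exists (mscale (NngNum PC0) (image_probability P mphi)) => D.
  by rewrite /= /mscale /= fineK.
have mS := measurable_step measurableT mA; rewrite setTI in mS.
suff : forall D, measurable D -> m1 D = m2 D.
  by move=> /(_ _ mS); rewrite m1E m2E muleC; exact.
apply: eq_measure_rectangles.
  rewrite m1E preimage_setT setTI.
  by rewrite (le_lt_trans (probability_le1 P mC)) ?ltry.
move=> A' B' mA' mB'; rewrite m1E m2E.
have phiE : phi @^-1` (A' `*` B') =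
  process S xi x n @^-1` A' `&` xi n @^-1` B' by [].
rewrite phiE.
have nJn : n \notin J.
  by apply/negP => /(allP nJ); rewrite ltnn.
pose B1 j := if j == n then B' else B j.
have mB1 j : measurable (B1 j) by rewrite /B1; case: ifP.
have cylE J' : n \notin J' -> cylinder J' B1 = cylinder J' B.
  move=> nJ'; apply: eq_bigcapr => j /= jJ'; rewrite /B1 ifF//.
  by apply/negP => /eqP jn; move: nJ'; rewrite -jn jJ'.
have cyl1 : cylinder [:: n] B1 = xi n @^-1` B'.
  apply/seteqP; split=> w; last first.
    by move=> h j /=; rewrite inE => /eqP ->; rewrite /B1 eqxx.
  by move=> /(_ n) /=; rewrite mem_head /B1 eqxx; exact.
have cylU : cylinder (n :: J) B1 = xi n @^-1` B' `&` cylinder J B.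
  rewrite -cyl1 -(cylE J)//; apply/seteqP; split.
    move=> w h; split => j /=; first by rewrite inE => /eqP ->; apply: h; rewrite /= mem_head.
    by move=> jJ; apply: h; rewrite /= inE jJ orbT.
  move=> w [h1 h2] j /=; rewrite inE => /orP[/eqP ->|jJ]; last exact: h2.
  by apply: h1; rewrite /= mem_head.
have nJ' : all (leq n) J by apply: sub_all nJ => j; exact: ltnW.
rewrite -setIA -cylU IH//=; [|by rewrite nJn|by rewrite leqnn].
rewrite -[in RHS]cyl1 IH//=; last by rewrite leqnn.
rewrite [RHS]muleCA; congr (_ * _)%E.
rewrite -[cylinder J B]cylE//.
rewrite /cylinder !xi_ind//=; last by rewrite nJn.
by rewrite big_cons big_seq1 muleC.
Qed.

(** The last step is peeled off: by [process_independent] the position and the noise at time [n]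
    have a product law, so Fubini integrates the noise out and leaves the mean of [markov_op f] at
    time [n]. *)
Lemma mean_process n x f : bounded_measurable f ->
  \int[P]_w f (process S xi x n w) = iter n markov_op f x.
Proof.
have [_ xi_law] := xi_iid.
elim: n f => [|n IH] f bf; first by rewrite /process /= mean_cst.
rewrite iterSr -IH; last exact: bounded_measurable_markov_op.
have mproc := measurable_process x n.
pose phi w : borel X * borel Z := (process S xi x n w : borel X, xi n w).
have mphi : measurable_fun setT phi by exact: (measurable_fun_pair mproc).
have bfS := bounded_measurable_comp measurable_step bf.
have -> : \int[P]_w f (process S xi x n.+1 w) =
    \int[image_probability P mphi]_p (f \o (fun p => S p.1 p.2)) p.
  by rewrite mean_image_probability.
rewrite -[RHS](mean_image_probability P mproc); last first.
  exact: bounded_measurable_markov_op.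
rewrite -(mean_fubini _ l bfS).
apply: eq_measure_mean => D mD; apply/esym.
apply: product_measure_unique => // A B mA mB.
have := @process_independent n x [:: n] (fun=> B) A.
rewrite /= leqnn => /(_ isT isT (fun=> mB) mA).
have -> : cylinder [:: n] (fun=> B) = xi n @^-1` B.
  apply/seteqP; split=> w; last by move=> h j /=; rewrite inE => /eqP ->.
  by move=> /(_ n) /=; rewrite mem_head; exact.
by have [_ /(_ B mB) <-] := xi_law n.
Qed.

Lemma transitionE n x (A : set (borel X)) : measurable A ->
  transition S xi n x A = (iter n markov_op \1_A x)%:E.
Proof.
move=> mA; rewrite -mean_process; last exact: bounded_measurable_indic.
rewrite -(mean_image_probability P (measurable_process x n)); last first.
  exact: bounded_measurable_indic.
by rewrite mean_indic.
Qed.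

(** The law of the process at time [n] when its starting point is drawn from [nu] independently of
    the noise. It turns the bare set function [dual_transition] into a probability. *)
Definition dual_probability n (nu : probability (borel X) R) :
    probability (borel X) R :=
  image_probability (nu \x P)%E (measurable_process2 n).

Lemma dual_transitionE n nu :
  dual_transition S xi n nu = dual_probability n nu :> (set (borel X) -> \bar R).
Proof.
apply/funext => A; apply: eq_integral => x _; rewrite /transition /=.
by congr (P _); apply/seteqP; split=> w; rewrite /xsection /= ?inE.
Qed.

Lemma mean_dual_probability n nu f : bounded_measurable f ->
  \int[dual_probability n nu]_x f x = \int[nu]_x iter n markov_op f x.
Proof.
move=> bf; rewrite mean_image_probability//.
rewrite (mean_fubini nu P
  (bounded_measurable_comp (measurable_process2 n) bf)).
by apply: eq_Rintegral => x _; rewrite -mean_process.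
Qed.

End process.
End markov_operator.

(** * Compactness of the attainable set *)

Section metric_compactness.
Context {R : realType}.

Lemma dist_to_lt (X : metricType R) (x : X) (A : set X) (t : R) :
  (dist_to x A < t%:E)%E -> exists2 y, A y & mdist x y < t.
Proof. by move=> /ereal_inf_lt[_ [y Ay <-]]; rewrite lte_fin; exists y. Qed.

Lemma compact_net (X : polishType R) (A : set X) (eps : R) :
  compact A -> 0 < eps ->
  exists s : seq X, forall x, A x -> exists2 y, y \in s & ball y eps x.
Proof.
rewrite compact_cover => cA eps0.
have [y _|x Ax|D' _ AD'] := cA X A (fun y => ball y eps).
- exact: open_ball.
- by exists x => //; exact: ballxx.
exists (finmap.enum_fset D') => x /AD'[y yD' xy]; exists y => //.
Qed.

(** An ultrafilter containing a finite union of balls contains one of them, so finite nets at every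
    scale make each ultrafilter on [K] Cauchy, and completeness gives its limit. *)
Lemma compact_of_nets (X : polishType R) (K : set X) : closed K ->
  (forall eps, 0 < eps ->
    exists s : seq X, forall x, K x -> exists2 y, y \in s & ball y eps x) ->
  compact K.
Proof.
move=> clK netK; rewrite compact_ultra => F FU FK.
have cauchyF : cauchy F.
  apply: cauchy_exP => eps eps0; have [s sK] := netK eps eps0.
  have : F (fun x => exists2 y, y \in s & ball y eps x) by exact: filterS FK.
  elim: s {sK} => [|y s IH] Fs.
    by have [x [y]] := filter_ex Fs.
  have [Fb|Fb] := in_ultra_setVsetC (ball y eps) FU; first by exists y.
  apply: IH; apply: filterS2 Fs Fb => x [u].
  by rewrite inE => /orP[/eqP -> //|us ux _]; exists u.
have Fx := @cauchy_cvg X F _ cauchyF.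
exists (lim F); split; [|exact: Fx]; apply: clK => B /Fx FB.
have FKB : F (K `&` B) by exact: filterI.
exact: filter_ex FKB.
Qed.

Lemma seq_mdist_bounded (X : metricType R) (s : seq X) (x : X) :
  exists M, forall y, y \in s -> mdist x y <= M.
Proof.
elim: s => [|y s [M sM]]; first by exists 0.
exists (Num.max M (mdist x y)) => z; rewrite inE => /orP[/eqP ->|/sM zM].
  by rewrite le_max lexx orbT.
by rewrite le_max zM.
Qed.

Lemma mbounded_neighborhood (X : polishType R) (A : set X) (t : R) :
  compact A -> mbounded [set x | (dist_to x A <= t%:E)%E].
Proof.
move=> /compact_net/(_ ltr01)[s sA].
have [M sM] := seq_mdist_bounded s point.
exists point, (t + M + 2) => x /= xA.
have [y Ay xy] : exists2 y, A y & mdist x y < t + 1.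
  by apply: dist_to_lt; rewrite (le_lt_trans xA)// lte_fin ltrDl.
have [u us] := sA y Ay; rewrite !ballEmdist /= => uy.
have := metric_triangle point u x; have := metric_triangle u y x.
by have := sM u us; rewrite (metric_sym y x); lra.
Qed.

Lemma expR_decay_lt (M kappa eps : R) : 0 < kappa -> 0 < eps -> 0 <= M ->
  exists N, forall n, (N <= n)%N -> M * expR (- kappa * n%:R) < eps.
Proof.
move=> k0 e0 M0; have ke : 0 < kappa * eps by rewrite mulr_gt0.
exists (Num.Def.archi_bound (M / (kappa * eps))) => n Nn.
have h : M / (kappa * eps) < n%:R.
  rewrite (lt_le_trans (archi_boundP _))// ?ler_nat//.
  by rewrite divr_ge0// ltW.
rewrite mulNr expRN ltr_pdivrMr ?expR_gt0//.
rewrite ltr_pdivrMr// in h.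
have := expR_ge1Dx (kappa * n%:R) => /(ler_wpM2l (ltW e0)).
nra.
Qed.

Lemma locally_lipschitz_continuous (X Z : polishType R) (S : X -> Z -> X) :
  locally_lipschitz S -> continuous (fun p : X * Z => S p.1 p.2).
Proof.
move=> LS p; apply/metricType_numDomainType.cvgrPdist_lt => eps eps0 /=.
have [|L SL] := LS (ball p 1); first by exists p, 1.
pose L' := `|L| + 1; have L'0 : 0 < L' by rewrite ltr_wpDl.
pose eps' := Num.min 1 (eps / L').
have eps'0 : 0 < eps' by rewrite lt_min ltr01 divr_gt0.
have := nbhsx_ballx p eps' eps'0; apply: filterS => q pq.
have pq1 : ball p 1 q by apply: le_ball pq; rewrite ge_min lexx.
have := SL p q (ballxx p ltr01) pq1; move/le_lt_trans; apply.
set m := Num.max _ _.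
have m0 : 0 <= m by rewrite le_max mdist_ge0.
have mL : m < eps / L'.
  case: pq; rewrite !ballEmdist /= => p1 p2.
  by rewrite /m gt_max !(lt_le_trans p1, lt_le_trans p2)// ge_min lexx orbT.
rewrite ltr_pdivlMr// in mL; apply: le_lt_trans mL.
rewrite mulrC ler_wpM2l// (le_trans (ler_norm _))// lerDl//.
Qed.

End metric_compactness.

Section iterS_lemmas.
Context {X Z : Type} (S : X -> Z -> X).

Lemma iterS_ext n x (zeta zeta' : nat -> Z) :
  (forall k, (k < n)%N -> zeta k = zeta' k) ->
  Defs.iterS S n x zeta = Defs.iterS S n x zeta'.
Proof.
elim: n => //= n IH h; rewrite IH ?h// => k kn; apply: h; exact: ltnW.
Qed.

Lemma iterS_shift n x (zeta : nat -> Z) :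
  Defs.iterS S n (S x (zeta 0%N)) (fun k => zeta k.+1) = Defs.iterS S n.+1 x zeta.
Proof. by elim: n => //= n ->. Qed.

End iterS_lemmas.

Section attainable_compact.
Context {R : realType} {X Z : polishType R} (S : X -> Z -> X).
Variables (E : set Z) (Y : set X) (V : X -> R).
Hypothesis cS : continuous (fun p : X * Z => S p.1 p.2).
Hypothesis cE : compact E.
Hypothesis acY : asymptotic_compactness S E Y V.

Local Notation K := (attainable_infty S E Y).

Lemma attainableS n :
  attainable S E Y n.+1 = (fun p => S p.1 p.2) @` (attainable S E Y n `*` E).
Proof.
apply/seteqP; split=> [_ [x Yx [zeta Ez <-]]|_ [[y z] [[x Yx [zeta Ez <-]] /= Eeq] <-]].
  exists (Defs.iterS S n x zeta, zeta n) => //; split=> /=; last exact: Ez.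
  by exists x => //; exists zeta => // k kn; apply: Ez; exact: ltnW.
exists x => //; exists (fun k => if (k < n)%N then zeta k else z) => [k _|/=].
  by case: ifP => // /Ez.
by rewrite ltnn; congr S; apply: iterS_ext => k ->.
Qed.

Lemma compact_attainable n : compact (attainable S E Y n).
Proof.
have [cY _ _ _ _] := acY.
elim: n => [|n IH]; last first.
  rewrite attainableS; apply: continuous_compact; last exact: compact_setX.
  exact: continuous_subspaceT.
suff -> : attainable S E Y 0 = Y by [].
apply/seteqP; split=> [_ [x Yx [zeta _ <-]]//|x Yx].
by exists x => //; exists point.
Qed.

Lemma attainable_infty_invariant x z : K x -> E z -> K (S x z).
Proof.
move=> Kx Ez B /= nB.
have : nbhs x [set y | B (S y z)].
  have cSz : continuous (fun y : X => S y z).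
    move=> y; apply: (@continuous_comp X _ X (fun y => (y, z)) (fun p => S p.1 p.2)).
      by apply: cvg_pair; [exact: cvg_id|exact: cvg_cst].
    exact: cS.
  exact: cSz.
move=> /Kx[y [[n _ Yy] BSy]]; exists (S y z); split=> //.
exists n.+1 => //; rewrite attainableS; exists (y, z) => //.
Qed.

Lemma attainable_infty_incl : Y `<=` K.
Proof.
move=> x Yx; apply: subset_closure; exists 0%N => //.
by exists x => //; exists point.
Qed.

Lemma closed_attainable_infty : closed K.
Proof. exact: closed_closure. Qed.

(** [V] is bounded on the compact [Y], so from some time [N] on all attainable sets are uniformly
    close to [Y] and a net of [Y] serves them; the finitely many earlier ones are compact. The three
    thirds of [eps] pay for the closure, the distance to [Y] and the net. *)
Lemma compact_attainable_infty : compact K.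
Proof.
have [cY _ V0 bV [kappa k0 acS]] := acY.
apply: compact_of_nets; first exact: closed_attainable_infty.
move=> eps eps0; have eps30 : 0 < eps / 3%:R by rewrite divr_gt0.
have [M VM] : exists M, forall x, Y x -> V x <= M.
  apply: bV; have [x [N h]] := mbounded_neighborhood 0 cY.
  exists x, N => y Yy; apply: h => /=; rewrite -(mdistxx y).
  by apply: ereal_inf_lbound; exists y.
have [N NP] := expR_decay_lt k0 eps30 (normr_ge0 M).
have [s0 s0P] := compact_net cY eps30.
have [s1 s1P] : exists s : seq X, forall n x, (n <= N)%N ->
    attainable S E Y n x -> exists2 y, y \in s & ball y (eps / 3%:R) x.
  elim: N {NP} => [|N [s sP]].
    have [s sP] := compact_net (@compact_attainable 0%N) eps30.
    by exists s => n x; rewrite leqn0 => /eqP ->; exact: sP.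
  have [s' sP'] := compact_net (@compact_attainable N.+1) eps30.
  exists (s ++ s') => n x; rewrite leq_eqVlt => /orP[/eqP ->|nN].
    by move=> /sP'[y ys xy]; exists y => //; rewrite mem_cat ys orbT.
  by move=> /(sP _ _ nN)[y ys xy]; exists y => //; rewrite mem_cat ys.
exists (s0 ++ s1) => x Kx.
have [x' [[n _ Yx'] xx']] := Kx _ (nbhsx_ballx x (eps / 3%:R) eps30).
have [nN|Nn] := leqP n N.
  have [y ys yx'] := s1P n x' nN Yx'; exists y.
    by rewrite mem_cat ys orbT.
  have := ball_triangle yx' (ball_sym xx'); apply: le_ball; lra.
have [u uY ux'] : exists2 u, Y u & mdist x' u < eps / 3%:R.
  apply: dist_to_lt.
  move: Yx' => [x0 Yx0 [zeta Ez <-]].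
  (* Asymptotic compactness asks for noise in [E] at all times, but [zeta] is controlled only before
     [n]; later values are replaced by [zeta 0], which is in [E] as [n > 0]. *)
  have Ez' k : E (if (k < n)%N then zeta k else zeta 0%N).
    by case: ifP => [/Ez//|_]; apply: Ez; exact: leq_ltn_trans Nn.
  have := acS x0 _ n Ez' (leq_ltn_trans (leq0n N) Nn).
  rewrite (@iterS_ext _ _ S n x0 _ zeta); last by move=> k ->.
  move/le_lt_trans; apply; rewrite lte_fin.
  apply: le_lt_trans (NP n (ltnW Nn)); rewrite ler_wpM2r ?expR_ge0//.
  by rewrite (le_trans (VM _ Yx0))// ler_norm.
have [y ys yu] := s0P u uY; exists y; first by rewrite mem_cat ys.
have x'u : ball u (eps / 3%:R) x' by rewrite ballEmdist /= metric_sym.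
have := ball_triangle (ball_triangle yu x'u) (ball_sym xx').
by apply: le_ball; lra.
Qed.

End attainable_compact.

(** * The comparison function *)

Section comparison.
Context {R : realType}.

(* [q] bounds the contraction factor of the cost [min 1 (phi d)] under one step
   of the coupling at points where [phi d < 1]. *)
Definition comparison (r q : R) (g phi : R -> R) : Prop :=
  [/\ 0 <= q < 1,
      forall s t, 0 <= s -> s <= t -> phi s <= phi t,
      forall eps, 0 < eps -> exists2 del, 0 < del &
        forall t, 0 <= t -> t <= del -> phi t <= eps,
      forall t, 0 <= t -> Num.min 1 t <= phi t &
      forall t, 0 <= t -> phi t < 1 -> phi (r * t) + g t <= q * phi t].

(** A limsup is an infimum of suprema over sets containing a tail, so one such supremum is already
    negative; it gives [- c], or [c = 1] if it is [-oo]. *)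
Lemma geometric_rate (r : R) (g : R -> R) : admissible_rate r g ->
  exists2 c, 0 < c & exists N, forall n, (N <= n)%N -> g (r ^+ n) <= expR (- c * n%:R).
Proof.
move=> [_ _ _ _ /ereal_inf_lt[_ [A [N _ NA] <-]]] supA.
have [c c0 Ac] : exists2 c : R, 0 < c &
    (ereal_sup [set ((n%:R^-1)%:E * lne (g (r ^+ n)%R)%:E)%E | n in A] <= (- c)%:E)%E.
  move: supA; case: ereal_sup => [s|//|_].
    by rewrite lte_fin => s0; exists (- s); rewrite ?oppr_gt0// opprK.
  by exists 1 => //; rewrite leNye.
(* The index 0 is discarded because its factor [0^-1] is 0 and says nothing about [g]. *)
exists c => //; exists (maxn 1 N) => n; rewrite geq_max => /andP[n1 Nn].
have {}Ac : ((n%:R^-1)%:E * lne (g (r ^+ n)%R)%:E <= (- c)%:E)%E.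
  by apply: le_trans Ac; apply: ereal_sup_ubound; exists n => //; exact: NA.
have [g0|g0] := leP (g (r ^+ n)) 0; first exact: le_trans (expR_ge0 _).
rewrite lne_EFin// -EFinM lee_fin mulrC ler_pdivrMr ?ltr0n// in Ac.
by rewrite -ler_expR lnK// in Ac.
Qed.

Lemma small_expn (r t : R) : 0 <= r -> r < 1 -> 0 < t -> exists n, r ^+ n <= t.
Proof.
move=> r0 r1 t0.
have /cvgrPdist_le/(_ t t0)[N _ /(_ N (leqnn _))] : r ^+ n @[n --> \oo] --> (0 : R).
  by apply: cvg_expr; rewrite ger0_norm.
rewrite /= sub0r normrN ger0_norm ?exprn_ge0// => h.
by exists N.
Qed.

(** A power [phi t = A t^al] is multiplied by [rho = r^al < 1] when [t] becomes [r t]. The choice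
    [al <= c / - ln r] means [exp (- c) <= rho], so [g] is dominated by a multiple of [t^al] near 0;
    a large [A] makes it at most [(1 - rho) / 2] times [phi], and [q = (1 + rho) / 2]. *)
Lemma comparison_exists_pos (r : R) (g : R -> R) : 0 < r -> r < 1 ->
  admissible_rate r g -> exists q phi, comparison r q g phi.
Proof.
move=> r0 r1 gr; have [c c0 [N gN]] := geometric_rate gr.
have [g_ge0 _ g_mono g0 _] := gr.
have lnr : 0 < - ln r by rewrite oppr_gt0 ln_lt0// r0.
pose al := Num.min 1 (c / - ln r).
have al0 : 0 < al by rewrite lt_min ltr01 divr_gt0.
have al1 : al <= 1 by rewrite ge_min lexx.
pose rho := r `^ al.
have rho0 : 0 < rho by rewrite powR_gt0.
have rho1 : rho < 1.
  have -> : 1 = 1 `^ al :> R by rewrite powR1.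
  by apply: gt0_ltr_powR; rewrite ?nnegrE// ltW.
have rhoc : expR (- c) <= rho.
  rewrite /rho /powR gt_eqF// ler_expR lerNl -mulrN.
  by rewrite -ler_pdivlMr// ge_min lexx orbT.
have {}gN n : (N <= n)%N -> g (r ^+ n) <= (r ^+ n) `^ al.
  move=> /gN/le_trans; apply.
  rewrite -powR_mulrn ?(ltW r0)// powRAC powR_mulrn; last exact: powR_ge0.
  have -> : expR (- c * n%:R) = expR (- c) ^+ n by rewrite mulrC expRM_natl.
  by apply: lerXn2r; rewrite ?nnegrE ?expR_ge0// ltW.
(* The bound along [r^n] passes to all [t] by monotonicity: bracketing [t] between [r^(n+1)] and
   [r^n] costs one factor [1 / rho]. *)
have gt t : 0 <= t -> t <= r ^+ N -> g t <= t `^ al / rho.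
  rewrite le_eqVlt => /predU1P[<- _|t0 tN]; first by rewrite g0 divr_ge0// ?powR_ge0// ltW.
  suff [n Nn /andP[nt tn]] : exists2 n, (N <= n)%N & r ^+ n.+1 <= t <= r ^+ n.
    apply: le_trans (g_mono _ _ (ltW t0) tn) _.
    apply: le_trans (gN n Nn) _.
    rewrite ler_pdivlMr// -powRM ?exprn_ge0// ?(ltW r0)//.
    apply: ge0_ler_powR; rewrite ?nnegrE ?mulr_ge0 ?exprn_ge0 ?(ltW t0) ?(ltW r0) ?(ltW al0)//.
    by rewrite -exprSr.
  have ex : exists n, r ^+ n <= t by apply: small_expn => //; exact: ltW.
  have [m mt mmin] := ex_minnP ex.
  have [mN|Nm] := leqP m N.
    exists N => //; rewrite tN andbT (le_trans _ mt)//.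
    by apply: ler_wiXn2l; rewrite ?(ltW r0) ?(ltW r1)//; exact: leqW.
  exists m.-1; first by rewrite -ltnS prednK// (leq_ltn_trans (leq0n N)).
  rewrite prednK ?(leq_ltn_trans (leq0n N))// mt /= leNgt; apply/negP => /ltW/mmin.
  by rewrite leqNgt ltn_predL (leq_ltn_trans (leq0n N)).
pose t0 := r ^+ N; have t00 : 0 < t0 by rewrite exprn_gt0.
(* The first term gives [min 1 t <= phi t], with the help of [al <= 1]. The second makes [phi >= 1]
   from [t0] on, so that [phi t < 1] confines [t] to the range where [g] is controlled. The third
   absorbs [g]. *)
pose A := 1 + (t0 `^ al)^-1 + 2 / (rho * (1 - rho)).
have h1 : 0 < (t0 `^ al)^-1 by rewrite invr_gt0 powR_gt0.
have rr0 : 0 < rho * (1 - rho) by rewrite mulr_gt0// subr_gt0.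
have h2 : 0 < 2 / (rho * (1 - rho)) by rewrite divr_gt0.
have A1 : 1 <= A by rewrite /A; lra.
have A0 : 0 < A by lra.
have mono s t : 0 <= s -> s <= t -> s `^ al <= t `^ al.
  move=> s0 st; have tp := le_trans s0 st.
  by apply: ge0_ler_powR; rewrite ?nnegrE//; exact: ltW.
exists ((1 + rho) / 2), (fun t => A * t `^ al); split.
- by lra.
- by move=> s t s0 st; rewrite ler_pM2l//; exact: mono.
- move=> eps eps0; have eA : 0 < eps / A by rewrite divr_gt0.
  exists ((eps / A) `^ al^-1); first by rewrite powR_gt0.
  move=> t tp td; rewrite mulrC -ler_pdivlMr//.
  rewrite (le_trans (mono _ _ tp td))// -powRrM mulVf ?gt_eqF// powRr1//; exact: ltW.
- move=> t tp; have [t1|t1] := leP t 1.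
    have [->|tn0] := eqVneq t 0; first by rewrite powR0 ?mulr0// gt_eqF.
    have tt : 0 < t <= 1 by rewrite lt_neqAle eq_sym tn0 tp t1.
    rewrite (le_trans (ger1_powR tt al1))// ler_peMl// powR_ge0//.
  have := mono 1 t ler01 (ltW t1); rewrite powR1 => h.
  by rewrite -[1]mulr1 ler_pM.
- move=> t tp phi1.
  have tt0 : t <= t0.
    rewrite leNgt; apply/negP => /ltW/(mono _ _ (ltW t00)) h.
    have t0al : 0 < t0 `^ al by rewrite powR_gt0.
    suff : 1 <= A * t `^ al by rewrite leNgt phi1.
    apply: (@le_trans _ _ (A * t0 `^ al)); last by rewrite ler_pM2l.
    by rewrite -ler_pdivrMr// mul1r /A; lra.
  have := gt t tp tt0.
  have tal : 0 <= t `^ al by exact: powR_ge0.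
  rewrite powRM//; last exact: ltW.
  rewrite -/rho.
  have AA : rho^-1 <= A * (1 - rho) / 2.
    rewrite ler_pdivlMr// -ler_pdivrMr ?subr_gt0//.
    have -> : rho^-1 * 2 / (1 - rho) = 2 / (rho * (1 - rho)) by rewrite invfM; ring.
    by rewrite /A; lra.
  have := ler_wpM2l tal AA.
  by lra.
Qed.

(** For [r = 0] the values [g (r ^+ n)] with [n > 0] are all [g 0], so no power of [t] can be
    compared with [g]. Instead [phi t = t + 2 g t] vanishes at [0 * t] and is at least [2 g t],
    whence [q = 1 / 2]; it is small near 0 by continuity of [g]. *)
Lemma comparison_exists (r : R) (g : R -> R) : 0 <= r -> r < 1 ->
  admissible_rate r g -> exists q phi, comparison r q g phi.
Proof.
rewrite le_eqVlt => /predU1P[<- _ gr|]; last exact: comparison_exists_pos.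
have [g_ge0 gc g_mono g0 _] := gr.
exists 2^-1, (fun t => t + 2 * g t); split.
- by lra.
- by move=> s t s0 st; have := g_mono _ _ s0 st; lra.
- move=> eps eps0.
  have gc0 : g t @[t --> within [set t : R | 0 <= t] (nbhs (0 : R))] --> (0 : R).
    rewrite -[X in _ --> X]g0.
    by have /subspace_continuousP/(_ (0 : R)) := gc; apply; exact: lexx.
  have e4 : 0 < eps / 4%:R by rewrite divr_gt0.
  move/cvgrPdist_le : gc0 => /(_ _ e4).
  rewrite near_withinE => /nbhs_ballP[del /= del0 h].
  exists (Num.min (del / 2) (eps / 2)); first by rewrite lt_min !divr_gt0.
  move=> t tp; rewrite le_min => /andP[td te].
  have := h t; rewrite /ball /= sub0r normrN ger0_norm// => /(_ _ tp).
  rewrite sub0r normrN ger0_norm ?g_ge0// => /(_ ltac:(lra)); lra.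
- by move=> t tp; rewrite ge_min; apply/orP; right; have := g_ge0 t tp; lra.
- by move=> t tp _; rewrite mul0r g0; lra.
Qed.

End comparison.

(** * Contraction on the invariant set *)

Section mean_extra.
Context {d : measure_display} {T : measurableType d} {R : realType}.
Variable mu : probability T R.

Lemma probability_setI1 (A B : set T) : measurable A -> measurable B ->
  mu A = 1%E -> mu B = 1%E -> mu (A `&` B) = 1%E.
Proof.
move=> mA mB A1 B1; have mAB : measurable (A `&` B) by exact: measurableI.
have mCA := measurableC mA; have mCB := measurableC mB.
rewrite -(setCK (A `&` B)) probability_setC; last exact: measurableC.
suff -> : mu (~` (A `&` B)) = 0%E by rewrite sube0.
apply/eqP; rewrite eq_le measure_ge0 andbT setCI.
rewrite (le_trans (measureU2 _ mCA mCB))//.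
have a0 : (mu (~` A) <= 0)%E by rewrite probability_setC// A1 subee.
have b0 : (mu (~` B) <= 0)%E by rewrite probability_setC// B1 subee.
by rewrite -[leRHS]adde0; exact: (leeD a0 b0).
Qed.

Lemma dist_mean_le_mean (A : set T) (f g h : T -> R) :
  measurable A -> mu A = 1%E -> bounded_measurable f -> bounded_measurable g ->
  bounded_measurable h -> (forall x, A x -> `|f x - g x| <= h x) ->
  `|\int[mu]_x f x - \int[mu]_x g x| <= \int[mu]_x h x.
Proof.
move=> mA muA bf bg bh fgh; rewrite -meanB// ler_norml.
have bfg := bounded_measurableB bf bg.
apply/andP; split; last first.
  by apply: (le_mean_full mA) => // x /fgh; rewrite ler_norml => /andP[].
rewrite lerNl -mulN1r -meanZ//; apply: (le_mean_full mA) => //.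
  exact: bounded_measurableZ.
by move=> x /fgh; rewrite ler_norml mulN1r; lra.
Qed.

End mean_extra.

Section invariant_set.
Context {R : realType} {X Z : polishType R} (S : X -> Z -> X).
Variables (l : probability (borel Z) R) (K : set X) (E : set Z).
Hypothesis cS : continuous (fun p : X * Z => S p.1 p.2).
Hypothesis mE : measurable (E : set (borel Z)).
Hypothesis lE : l E = 1%E.
Hypothesis SK : forall x z, K x -> E z -> K (S x z).
Implicit Types f g : borel X -> R.

Local Notation T := (markov_op S l).
Local Notation bmT := (bounded_measurable_iter_markov_op l cS).

Lemma le_iter_markov_op n f g : bounded_measurable f -> bounded_measurable g ->
  (forall y, K y -> f y <= g y) ->
  forall x, K x -> iter n T f x <= iter n T g x.
Proof.
move=> bf bg fg; elim: n => [x Kx|n IH x Kx] /=; first exact: fg.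
apply: (le_mean_full mE lE); [| |by move=> z Ez; apply/IH/SK].
- by apply: bounded_measurable_step => //; exact: bmT.
- by apply: bounded_measurable_step => //; exact: bmT.
Qed.

Lemma iter_markov_op_affine n f a b : bounded_measurable f ->
  forall x, iter n T (fun y => a + b * f y) x = a + b * iter n T f x.
Proof.
move=> bf; elim: n => //= n IH x.
transitivity (\int[l]_z (a + b * iter n T f (S x z))).
  by apply: eq_Rintegral => z _; rewrite IH.
have bn : bounded_measurable (fun z : borel Z => iter n T f (S x z)).
  by apply: bounded_measurable_step => //; exact: bmT.
rewrite meanD ?mean_cst ?meanZ//; first exact: bounded_measurable_cst.
exact: bounded_measurableZ.
Qed.

Lemma iter_markov_op_dist n f c M : bounded_measurable f ->
  (forall y, K y -> `|f y - c| <= M) ->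
  forall x, K x -> `|iter n T f x - c| <= M.
Proof.
move=> bf fc x Kx.
(* The constants [c + M] and [c - M] are written as affine functions of [f], so that
   [iter_markov_op_affine] computes their images. *)
have bcst a : bounded_measurable (fun y => a + 0 * f y).
  by apply: bounded_measurableD;
    [exact: bounded_measurable_cst|exact: bounded_measurableZ].
have h1 := le_iter_markov_op n bf (bcst (c + M)) _ Kx.
have h2 := le_iter_markov_op n (bcst (c - M)) bf _ Kx.
rewrite iter_markov_op_affine// mul0r addr0 in h1.
rewrite iter_markov_op_affine// mul0r addr0 in h2.
rewrite ler_norml; apply/andP; split.
  rewrite lerBrDl; apply: h2 => y /fc.
  by rewrite ler_norml; lra.
rewrite lerBlDl; apply: h1 => y /fc.
by rewrite ler_norml; lra.
Qed.

End invariant_set.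

Section contraction.
Context {R : realType} {X Z : polishType R} (S : X -> Z -> X).
Variables (l : probability (borel Z) R) (K : set X) (E : set Z).
Hypothesis cS : continuous (fun p : X * Z => S p.1 p.2).
Hypothesis mE : measurable (E : set (borel Z)).
Hypothesis lE : l E = 1%E.
Hypothesis SK : forall x z, K x -> E z -> K (S x z).
Hypothesis clK : closed K.
Variables (r q : R) (g phi : R -> R).
Hypothesis r0 : 0 <= r.
Hypothesis phiP : comparison r q g phi.

Local Notation T := (markov_op S l).
Implicit Types f : borel X -> R.

Definition cost (x y : X) : R := Num.min 1 (phi (mdist x y)).

Definition cost_lipschitz (c : R) f : Prop :=
  bounded_measurable f /\
  forall x y, K x -> K y -> `|f x - f y| <= c * cost x y.

Let mK : measurable (K : set (borel X)).
Proof. exact: (@borel_closed R X). Qed.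

(** Almost surely both images lie in [K], where [f] varies by at most [c] times the cost. The cost
    is at most [phi (r d)] on the good event and at most 1 on the bad one, of probability at most
    [g d]; using 1 everywhere gives the other term of the minimum. *)
Lemma markov_op_coupling {d' : measure_display} {Omega' : measurableType d'}
    (P' : probability Omega' R) (a a' : Omega' -> borel X) (x x' : X) c f :
  0 <= c -> K x -> K x' ->
  measurable_fun [set: Omega'] a -> measurable_fun [set: Omega'] a' ->
  (forall A, measurable A -> P' (a @^-1` A) = (T \1_A x)%:E) ->
  (forall A, measurable A -> P' (a' @^-1` A) = (T \1_A x')%:E) ->
  (P' [set w | (r * mdist x x' < mdist (a w : X) (a' w : X))%R]
     <= (g (mdist x x'))%:E)%E ->
  cost_lipschitz c f ->
  `|T f x - T f x'| <= c * Num.min 1 (phi (r * mdist x x') + g (mdist x x')).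
Proof.
move=> c0 Kx Kx' ma ma' lawa lawa' bad [bf fK].
have [_ phi_mono _ phi_min _] := phiP.
have T_law (b : Omega' -> borel X) y : measurable_fun setT b -> K y ->
    (forall A, measurable A -> P' (b @^-1` A) = (T \1_A y)%:E) ->
    T f y = \int[P']_w f (b w) /\ P' (b @^-1` K) = 1%E.
  move=> mb Ky lawb; split.
    rewrite -(mean_image_probability P' mb bf).
    have mSy : measurable_fun setT (fun z : borel Z => S y z : borel X).
      exact: (measurable_fun_pair2 (y : borel X) (measurable_step cS)).
    have TE h : bounded_measurable h ->
        T h y = \int[image_probability l mSy]_u h u.
      by move=> bh; exact/esym/(mean_image_probability l mSy bh).
    rewrite TE//; apply: eq_measure_mean => A mA.
    rewrite -mean_indic// -TE; last exact: bounded_measurable_indic.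
    exact/esym/lawb.
  (* The mass given to [K] is [T] applied to the indicator of [K], which equals 1 on the invariant
     set [K]. *)
  rewrite lawb//; congr (_%:E); apply/eqP; rewrite -subr_eq0 -normr_le0.
  apply: (iter_markov_op_dist cS mE lE SK 1%N) => //.
    exact: bounded_measurable_indic.
  by move=> u Ku; rewrite indicE mem_set// subrr normr0.
have [-> Ka] := T_law a x ma Kx lawa.
have [-> Ka'] := T_law a' x' ma' Kx' lawa'.
pose G := a @^-1` K `&` a' @^-1` K.
have mpre (b : Omega' -> borel X) : measurable_fun setT b -> measurable (b @^-1` K).
  by move=> mb; rewrite -[X in measurable X]setTI; exact: mb.
have mG : measurable G by apply: measurableI; exact: mpre.
have PG : P' G = 1%E by apply: probability_setI1 => //; exact: mpre.
set B := [set w | _] in bad.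
have mB : measurable B.
  have mdist_aa' : measurable_fun setT (fun w => mdist (a w : X) (a' w : X)).
    have md := continuous_measurable_prod_real (@mdist_continuous R X).
    exact: (measurableT_comp md (measurable_fun_pair ma ma')).
  have -> : B = (fun w => mdist (a w : X) (a' w : X)) @^-1` `]r * mdist x x', +oo[.
    by apply/seteqP; split=> w; rewrite /B /= in_itv/= andbT.
  by rewrite -[X in measurable X]setTI; apply: mdist_aa'.
have bfa := bounded_measurable_comp ma bf.
have bfa' := bounded_measurable_comp ma' bf.
have b1 := bounded_measurable_indic (R := R) mB.
have far : `|\int[P']_w f (a w) - \int[P']_w f (a' w)| <= c.
  apply: (dist_mean2_full mG PG) => // w [Kaw Ka'w].
  rewrite (le_trans (fK _ _ Kaw Ka'w))// ler_piMr//.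
  by rewrite /cost ge_min lexx.
have near : `|\int[P']_w f (a w) - \int[P']_w f (a' w)| <=
    c * (phi (r * mdist x x') + g (mdist x x')).
  apply: (@le_trans _ _ (\int[P']_w (c * phi (r * mdist x x') + c * \1_B w))).
    apply: (dist_mean_le_mean mG PG) => //.
      by apply: bounded_measurableD;
    [exact: bounded_measurable_cst|exact: bounded_measurableZ].
    move=> w [Kaw Ka'w]; rewrite (le_trans (fK _ _ Kaw Ka'w))//.
    rewrite -mulrDr ler_wpM2l// indicE.
    have [/set_mem _|/negP nB] := boolP (w \in B).
      rewrite (@le_trans _ _ 1)//; first by rewrite /cost ge_min lexx.
      rewrite lerDr; have d0 : 0 <= r * mdist x x' by rewrite mulr_ge0// mdist_ge0.
      by rewrite (le_trans _ (phi_min _ d0))// le_min ler01.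
    rewrite addr0 /cost ge_min; apply/orP; right; apply: phi_mono.
      exact: mdist_ge0.
    by rewrite leNgt; apply/negP => ?; apply: nB; exact: mem_set.
  rewrite meanD ?mean_cst ?meanZ//;
    [|exact: bounded_measurable_cst|exact: bounded_measurableZ].
  rewrite mulrDr lerD2l ler_wpM2l//.
  by rewrite -lee_fin mean_indic.
by rewrite minr_pMr// mulr1 le_min far near.
Qed.

(** On [K] the values of [f] lie in [[b - c, b]], and on the ball within [c / 4] of [f z]. So a mass
    [p] in the ball lowers the upper bound by [w p] and raises the lower one by [w' p]. Wherever
    [f z] lies, [w + w' = c / 2], which is the gain [p / 2] in the factor. *)
Lemma markov_op_ball_contraction (z : X) (p eps c : R) m f :
  0 <= c -> K z -> (forall t, 0 <= t -> t <= eps -> phi t <= 4%:R^-1) ->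
  0 <= p -> (forall x, K x -> p <= iter m T \1_(ball z eps) x) ->
  cost_lipschitz c f ->
  forall x x', K x -> K x' ->
    `|iter m T f x - iter m T f x'| <= (1 - p / 2) * c.
Proof.
move=> c0 Kz phieps p0 ballp [bf fK].
have mball : measurable (ball z eps : set (borel X)).
  by apply: (@borel_open R X); exact: open_ball.
have b1 := bounded_measurable_indic (R := R) mball.
have cost1 x y : c * cost x y <= c by rewrite ler_piMr// /cost ge_min lexx.
pose b := sup (f @` K).
have K_sup : has_sup (f @` K).
  split; first by exists (f z), z.
  by exists (f z + c) => _ [y Ky <-]; have := fK _ _ Ky Kz;
    have := cost1 y z; rewrite ler_norml; lra.
have fb y : K y -> f y <= b by move=> Ky; apply: sup_upper_bound => //; exists y.
have bf' y : K y -> b - c <= f y.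
  move=> Ky; rewrite lerBlDr; apply: ge_sup; first by exists (f z), z.
  by move=> _ [u Ku <-]; have := fK _ _ Ku Ky; have := cost1 u y; rewrite ler_norml; lra.
have f_ball y : K y -> ball z eps y -> `|f y - f z| <= c / 4%:R.
  move=> Ky; rewrite ballEmdist /= => zy.
  rewrite (le_trans (fK _ _ Ky Kz))// ler_wpM2l// /cost ge_min.
  by apply/orP; right; apply: phieps; rewrite ?mdist_ge0// metric_sym ltW.
have baff a e : bounded_measurable (fun y => a + e * (\1_(ball z eps) : borel X -> R) y).
  by apply: bounded_measurableD;
    [exact: bounded_measurable_cst|exact: bounded_measurableZ].
pose w := b - f z - c / 4%:R; pose w' := f z - c / 4%:R - (b - c).
have up x : K x -> iter m T f x <= b - w * p.
  (* For negative [w] the claim is weaker than [b], which bounds the iterates because [K] is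
     invariant; only for [w >= 0] may the lower bound [p] be inserted. *)
  move=> Kx; have [w0|w0] := leP 0 w; last first.
    have := iter_markov_op_dist cS mE lE SK m (c := b - c / 2) (M := c / 2) bf _ Kx.
    rewrite ler_norml => h; have {h} : iter m T f x <= b.
      suff /h/andP[] : forall y, K y -> `|f y - (b - c / 2)| <= c / 2 by lra.
      by move=> y Ky; have := fb y Ky; have := bf' y Ky; rewrite ler_norml; lra.
    by move/le_trans; apply; rewrite lerDl oppr_ge0 mulr_le0_ge0// ltW.
  have h := le_iter_markov_op cS mE lE SK m bf (baff b (- w)) _ Kx.
  rewrite (le_trans (h _))//.
    move=> y Ky; rewrite indicE; have [/set_mem yB|_] := boolP (y \in _).
      by rewrite mulr1; have := f_ball y Ky yB; rewrite ler_norml /w; lra.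
    by rewrite mulr0; have := fb y Ky; lra.
  by rewrite iter_markov_op_affine// mulNr lerD2l lerN2 ler_wpM2l// ballp.
have lo x : K x -> b - c + w' * p <= iter m T f x.
  move=> Kx; have [w0|w0] := leP 0 w'; last first.
    have := iter_markov_op_dist cS mE lE SK m (c := b - c / 2) (M := c / 2) bf _ Kx.
    rewrite ler_norml => h; have {h} : b - c <= iter m T f x.
      suff /h/andP[] : forall y, K y -> `|f y - (b - c / 2)| <= c / 2 by lra.
      by move=> y Ky; have := fb y Ky; have := bf' y Ky; rewrite ler_norml; lra.
    by apply: le_trans; rewrite gerDl mulr_le0_ge0// ltW.
  have h := le_iter_markov_op cS mE lE SK m (baff (b - c) w') bf _ Kx.
  rewrite (le_trans _ (h _))//; last first.
    move=> y Ky; rewrite indicE; have [/set_mem yB|_] := boolP (y \in _).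
      by rewrite mulr1; have := f_ball y Ky yB; rewrite ler_norml /w'; lra.
    by rewrite mulr0; have := bf' y Ky; lra.
  by rewrite iter_markov_op_affine// lerD2l ler_wpM2l// ballp.
move=> x x' Kx Kx'.
have := up x Kx; have := lo x Kx; have := up x' Kx'; have := lo x' Kx'.
have -> : w = (b - f z - c / 4%:R) by [].
have -> : w' = (f z - c / 4%:R - (b - c)) by [].
by rewrite ler_norml; nra.
Qed.

(* Discharged by [markov_op_coupling]. *)
Hypothesis T_step : forall c f x x', 0 <= c -> K x -> K x' ->
  cost_lipschitz c f ->
  `|T f x - T f x'| <= c * Num.min 1 (phi (r * mdist x x') + g (mdist x x')).

Lemma cost_ge0 x y : 0 <= cost x y.
Proof.
have [_ _ _ phi_min _] := phiP.
have := phi_min _ (mdist_ge0 x y); rewrite /cost le_min ler01 /=; apply: le_trans.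
by rewrite le_min ler01 mdist_ge0.
Qed.

Lemma cost_lipschitz_markov_op c f : 0 <= c -> cost_lipschitz c f ->
  cost_lipschitz c (T f).
Proof.
move=> c0 fc; have [_ _ _ phi_min phi_contr] := phiP; have [q01 _ _ _ _] := phiP.
split; first by apply: bounded_measurable_markov_op => //; case: fc.
move=> x y Kx Ky; rewrite (le_trans (T_step c0 Kx Ky fc))// ler_wpM2l// /cost.
have [phi1|phi1] := ltP (phi (mdist x y)) 1; last by rewrite ge_min lexx.
rewrite ge_min; apply/orP; right.
rewrite (le_trans (phi_contr _ (mdist_ge0 x y) phi1))//.
have := cost_ge0 x y; rewrite /cost min_r ?(ltW phi1)// => phi0.
by rewrite ler_piMl// ltW//; case/andP: q01.
Qed.

Lemma cost_lipschitz_iter_markov_op n c f : 0 <= c -> cost_lipschitz c f ->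
  cost_lipschitz c (iter n T f).
Proof. by move=> c0 fc; elim: n => //= n; exact: cost_lipschitz_markov_op. Qed.

Variables (z : X) (p eps : R) (m : nat).
Hypotheses (Kz : K z) (p0 : 0 < p) (m1 : (0 < m)%N).
Hypothesis phieps : forall t, 0 <= t -> t <= eps -> phi t <= 4%:R^-1.
Hypothesis ballp : forall x, K x -> p <= iter m T \1_(ball z eps) x.

Let q' := Num.max q (1 - p / 2).

(** When [phi < 1], a single one of the [m] steps contracts, by [q], and the other [m - 1] do no
    harm. When [phi >= 1] the cost is 1, so the oscillation bound over [m] steps is already a
    Lipschitz bound. *)
Lemma cost_lipschitz_contraction c f : 0 <= c -> cost_lipschitz c f ->
  cost_lipschitz (q' * c) (iter m T f).
Proof.
move=> c0 fc; have [q01 _ _ _ phi_contr] := phiP.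
split; first by apply: bounded_measurable_iter_markov_op => //; case: fc.
move=> x y Kx Ky; have [phi1|phi1] := ltP (phi (mdist x y)) 1; last first.
  rewrite /cost min_l// mulr1.
  rewrite (le_trans (markov_op_ball_contraction c0 Kz phieps (ltW p0) ballp fc Kx Ky))//.
  by rewrite ler_wpM2r// le_max lexx orbT.
rewrite -(prednK m1) iterS.
have fc' := cost_lipschitz_iter_markov_op m.-1 c0 fc.
rewrite (le_trans (T_step c0 Kx Ky fc'))//.
have := cost_ge0 x y; rewrite /cost min_r ?(ltW phi1)// => phi0.
rewrite mulrAC mulrC ler_wpM2r//.
rewrite ge_min; apply/orP; right.
rewrite (le_trans (phi_contr _ (mdist_ge0 x y) phi1))//.
by rewrite ler_wpM2r// le_max lexx.
Qed.

Lemma cost_lipschitz_decay c f n : 0 <= c -> cost_lipschitz c f ->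
  forall x y, K x -> K y ->
  `|iter n T f x - iter n T f y| <= q' ^+ (n %/ m) * c.
Proof.
move=> c0 fc.
have q'0 : 0 <= q' by have [/andP[q0 _] _ _ _ _] := phiP; rewrite le_max q0.
have decay k : cost_lipschitz (q' ^+ k * c) (iter (k * m) T f).
  elim: k => [|k IH]; first by rewrite mul1r.
  rewrite mulSn iterD exprS -mulrA; apply: cost_lipschitz_contraction => //.
  by rewrite mulr_ge0// exprn_ge0.
move=> x y Kx Ky; rewrite [in X in `|X|](divn_eq n m) addnC iterD.
have c0' : 0 <= q' ^+ (n %/ m) * c by rewrite mulr_ge0// exprn_ge0.
have [_ h2] := cost_lipschitz_iter_markov_op (n %% m)%N c0' (decay (n %/ m)%N).
rewrite (le_trans (h2 x y Kx Ky))// ler_piMr ?mulr_ge0 ?exprn_ge0//.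
by rewrite /cost ge_min lexx.
Qed.

End contraction.

(** * Bounded continuous functions *)

Section bounded_continuous.
Context {R : realType} {X : polishType R}.
Implicit Types (f g h : X -> R) (U : set X).

Definition bounded_continuous f :=
  continuous f /\ exists M, forall x, `|f x| <= M.

Lemma bounded_continuous_cst c : bounded_continuous (cst c).
Proof. by split=> [x|]; [exact: cvg_cst|exists `|c|]. Qed.

Lemma bounded_continuousD f g : bounded_continuous f -> bounded_continuous g ->
  bounded_continuous (fun x => f x + g x).
Proof.
move=> [cf [M fM]] [cg [N gN]]; split.
  by move=> x; apply: cvgD; [exact: cf|exact: cg].
by exists (M + N) => x; rewrite (le_trans (ler_normD _ _))// lerD.
Qed.

Lemma bounded_continuousZ c f : bounded_continuous f ->
  bounded_continuous (fun x => c * f x).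
Proof.
move=> [cf [M fM]]; split.
  by move=> x; apply: cvgM; [exact: cvg_cst|exact: cf].
by exists (`|c| * M) => x; rewrite normrM ler_wpM2l.
Qed.

Lemma bounded_continuous_max f g : bounded_continuous f -> bounded_continuous g ->
  bounded_continuous (fun x => Num.max (f x) (g x)).
Proof.
move=> [cf [M fM]] [cg [N gN]]; split.
  by move=> x; apply: continuous_max; [exact: cf|exact: cg].
exists (M + N) => x.
have := fM x; have := gN x; by rewrite !ler_norml; have [] := leP (f x) (g x); lra.
Qed.

Lemma bounded_continuous_min f g : bounded_continuous f -> bounded_continuous g ->
  bounded_continuous (fun x => Num.min (f x) (g x)).
Proof.
move=> [cf [M fM]] [cg [N gN]]; split.
  by move=> x; apply: continuous_min; [exact: cf|exact: cg].
exists (M + N) => x.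
have := fM x; have := gN x; by rewrite !ler_norml; have [] := leP (f x) (g x); lra.
Qed.

Lemma bounded_continuous_sum (F : nat -> X -> R) n :
  (forall i, bounded_continuous (F i)) ->
  bounded_continuous (fun x => \sum_(i < n) F i x).
Proof.
move=> bF; elim: n => [|n IH].
  have -> : (fun x => \sum_(i < 0) F i x) = cst 0.
    by apply/funext => x; rewrite big_ord0.
  exact: bounded_continuous_cst.
have -> : (fun x => \sum_(i < n.+1) F i x) = (fun x => \sum_(i < n) F i x + F n x).
  by apply/funext => x; rewrite big_ord_recr.
exact: bounded_continuousD.
Qed.

Lemma bounded_continuous_measurable f : bounded_continuous f ->
  bounded_measurable (f : borel X -> R).
Proof. by move=> [cf bf]; split=> //; exact: continuous_borel_measurable. Qed.

Lemma lipschitz_continuous (L : R) f :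
  (forall x y, `|f x - f y| <= L * mdist x y) -> continuous f.
Proof.
move=> fL x; apply/cvgrPdist_lt => eps eps0.
have L1 : 0 < `|L| + 1 by rewrite ltr_wpDl.
have e0 : 0 < eps / (`|L| + 1) by rewrite divr_gt0.
have := nbhsx_ballx x _ e0; apply: filterS => y; rewrite ballEmdist /= => xy.
rewrite (le_lt_trans (fL _ _))//; rewrite ltr_pdivlMr// in xy.
apply: le_lt_trans xy; rewrite mulrC ler_wpM2l ?mdist_ge0//.
by rewrite (le_trans (ler_norm _))// lerDl.
Qed.

(* The distance to [A] truncated at 1, so that it is 1 when [A] is empty. *)
Definition tdist (A : set X) (x : X) : R :=
  inf ([set 1] `|` (@mdist R X x @` A)).

Let tdist_has_inf A x : has_inf ([set 1] `|` (@mdist R X x @` A)).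
Proof.
split; first by exists 1; left.
by exists 0 => _ [->|[y _ <-]]; rewrite ?ler01// mdist_ge0.
Qed.

Lemma tdist_ge0 A x : 0 <= tdist A x.
Proof.
apply: lb_le_inf; first by exists 1; left.
by move=> _ [->|[y _ <-]]; rewrite ?ler01// mdist_ge0.
Qed.

Lemma tdist_le1 A x : tdist A x <= 1.
Proof. by apply: ge_inf; [have [] := tdist_has_inf A x|left]. Qed.

Lemma tdist_eq0 A x : A x -> tdist A x = 0.
Proof.
move=> Ax; apply/eqP; rewrite eq_le tdist_ge0 andbT -(mdistxx x).
by apply: ge_inf; [have [] := tdist_has_inf A x|right; exists x].
Qed.

Lemma tdist_gt0 A x : closed A -> ~ A x -> 0 < tdist A x.
Proof.
rewrite -openC => /metric_openP oA nAx; have [eps eps0 xA] := oA x nAx.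
apply: (@lt_le_trans _ _ (Num.min 1 eps)); first by rewrite lt_min ltr01.
apply: lb_le_inf; first by exists 1; left.
move=> _ [->|[y Ay <-]]; first by rewrite ge_min lexx.
rewrite ge_min; apply/orP; right; rewrite leNgt; apply/negP => xy.
by apply: (xA y) => //; rewrite ballEmdist.
Qed.

Lemma tdist_lipschitz A x y : `|tdist A x - tdist A y| <= 1 * mdist x y.
Proof.
rewrite mul1r.
suff h u v : tdist A u - mdist u v <= tdist A v.
  by have := h x y; have := h y x; rewrite (metric_sym y x) ler_norml; lra.
apply: lb_le_inf; first by exists 1; left.
move=> _ [->|[w Aw <-]].
  by have := tdist_le1 A u; have := mdist_ge0 u v; lra.
have : tdist A u <= mdist u w.
  by apply: ge_inf; [have [] := tdist_has_inf A u|right; exists w].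
by have := metric_triangle u v w; lra.
Qed.

(** Lipschitz functions vanishing off [U] that increase to the indicator of an open [U]. They serve
    both to build a measure and to identify one. *)
Definition open_bump U (n : nat) (x : X) : R :=
  Num.min 1 (n%:R * tdist (~` U) x).

Lemma open_bump_continuous U n : bounded_continuous (open_bump U n).
Proof.
apply: bounded_continuous_min; first exact: bounded_continuous_cst.
apply: bounded_continuousZ; split; last first.
  by exists 1 => x; rewrite ger0_norm ?tdist_ge0// tdist_le1.
by apply: lipschitz_continuous => x y; exact: tdist_lipschitz.
Qed.

Lemma open_bump_ge0 U n x : 0 <= open_bump U n x.
Proof. by rewrite le_min ler01 mulr_ge0// tdist_ge0. Qed.

Lemma open_bump_le1 U n x : open_bump U n x <= 1.
Proof. by rewrite ge_min lexx. Qed.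

Lemma open_bump_notin U n x : ~ U x -> open_bump U n x = 0.
Proof. by move=> nUx; rewrite /open_bump tdist_eq0// mulr0 min_r. Qed.

Lemma open_bump_lipschitz U n x y :
  `|open_bump U n x - open_bump U n y| <= n%:R * mdist x y.
Proof.
have := tdist_lipschitz (~` U) x y; rewrite mul1r /open_bump.
move=> /(ler_wpM2l (ler0n R n)); rewrite -[in X in X <= _](ger0_norm (ler0n R n)).
rewrite -normrM mulrBr; move: (n%:R * _) (n%:R * _) (n%:R * _) => a b c.
by rewrite !ler_norml; have [] := leP 1 a; have [] := leP 1 b; lra.
Qed.

Lemma open_bump_mono U m n x : (m <= n)%N -> open_bump U m x <= open_bump U n x.
Proof.
move=> mn; rewrite /open_bump le_min !ge_min lexx /=; apply/orP; right.
by rewrite ler_wpM2r ?tdist_ge0// ler_nat.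
Qed.

Lemma open_bump_eq1 U x : open U -> U x ->
  exists N, forall n, (N <= n)%N -> open_bump U n x = 1.
Proof.
move=> oU Ux; have t0 : 0 < tdist (~` U) x.
  by apply: tdist_gt0; [exact: open_closedC|exact].
exists (Num.Def.archi_bound (tdist (~` U) x)^-1) => n Nn.
rewrite /open_bump min_l// -ler_pdivrMr// mul1r.
rewrite (le_trans (ltW (archi_boundP _)))// ?ler_nat// invr_ge0 ltW//.
Qed.

Lemma open_bump_cvg U x : open U ->
  open_bump U n x @[n --> \oo] --> (\1_U x : R).
Proof.
move=> oU; rewrite indicE; have [Ux|nUx] := pselect (U x).
  have [N NP] := open_bump_eq1 oU Ux; rewrite mem_set//.
  by apply: cvg_near_cst; exists N => // n /= /NP.
rewrite memNset//; apply: cvg_near_cst; apply: nearW => n.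
exact: open_bump_notin.
Qed.

End bounded_continuous.

(** * A Riesz representation theorem *)

Section riesz.
Context {R : realType} {X : polishType R}.
Variables (K : set X) (Lam : (X -> R) -> R).
Hypothesis cK : compact K.
Hypothesis LamD : forall f g, bounded_continuous f -> bounded_continuous g ->
  Lam (fun x => f x + g x) = Lam f + Lam g.
Hypothesis LamZ : forall c f, bounded_continuous f ->
  Lam (fun x => c * f x) = c * Lam f.
Hypothesis Lam1 : Lam (cst 1) = 1.
Hypothesis Lam_le : forall f g, bounded_continuous f -> bounded_continuous g ->
  (forall x, K x -> f x <= g x) -> Lam f <= Lam g.

Let bcst (c : R) : bounded_continuous (cst c : X -> R).
Proof. exact: bounded_continuous_cst. Qed.

Let Lam_cst c : Lam (cst c) = c.
Proof.
have b1 := bounded_continuousZ c (bcst 1).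
by apply/eqP; rewrite eq_le -{2 3}[c]mulr1 -{1 2}Lam1 -LamZ//;
  apply/andP; split; apply: Lam_le => // x _; rewrite mulr1.
Qed.

(** [X] is not assumed locally compact, so the test functions of the Riesz construction vanish off
    [U] instead of having compact support in it. Compactness enters through [K], the only place
    where [Lam_le] compares functions. *)
Definition below (U : set X) (f : X -> R) : Prop :=
  [/\ bounded_continuous f, forall x, 0 <= f x <= 1 & forall x, ~ U x -> f x = 0].

Definition open_content (U : set X) : \bar R :=
  ereal_sup [set (Lam f)%:E | f in below U].

Definition outer_content (A : set X) : \bar R :=
  ereal_inf [set open_content U | U in [set U | open U /\ A `<=` U]].

Let below0 U : below U (cst 0).
Proof. by split=> [|x|//]; [exact: bcst|rewrite lexx ler01]. Qed.

Let Lam_below U f : below U f -> ((Lam f)%:E <= open_content U)%E.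
Proof. by move=> fU; apply: ereal_sup_ubound; exists f. Qed.

Let open_content_ge0 U : (0 <= open_content U)%E.
Proof. by have := Lam_below (below0 U); rewrite Lam_cst. Qed.

Let open_content_le1 U : (open_content U <= 1)%E.
Proof.
apply: ge_ereal_sup => _ [f [bf f01 _] <-]; rewrite lee_fin -(Lam_cst 1).
by apply: Lam_le => // x _; have /andP[] := f01 x.
Qed.

Let open_content_fin U : open_content U \is a fin_num.
Proof.
rewrite ge0_fin_numE//; exact: le_lt_trans (open_content_le1 U) (ltry 1).
Qed.

Let le_open_content U U' : U `<=` U' -> (open_content U <= open_content U')%E.
Proof.
move=> UU'; apply: ge_ereal_sup => _ [f [bf f01 fU] <-]; apply: Lam_below.
by split=> // x nU'x; apply: fU => /UU'.
Qed.

Let outer_content_open U : open U -> outer_content U = open_content U.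
Proof.
move=> oU; apply/eqP; rewrite eq_le; apply/andP; split.
  by apply: ereal_inf_lbound; exists U => //; split.
by apply: le_ereal_inf_tmp => _ [U' [_ UU'] <-]; exact: le_open_content.
Qed.

Let outer_content_ge0 A : (0 <= outer_content A)%E.
Proof. by apply: le_ereal_inf_tmp => _ [U _ <-]. Qed.

Let outer_content_le U A : open U -> A `<=` U ->
  (outer_content A <= open_content U)%E.
Proof. by move=> oU AU; apply: ereal_inf_lbound; exists U. Qed.

Let outer_content_fin A : outer_content A \is a fin_num.
Proof.
rewrite ge0_fin_numE//; apply: (@le_lt_trans _ _ (open_content setT)).
  by apply: outer_content_le => //; exact: openT.
by rewrite -ge0_fin_numE.
Qed.

Let outer_content0 : outer_content set0 = 0%E.
Proof.
rewrite outer_content_open; last exact: open0.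
apply/eqP; rewrite eq_le open_content_ge0 andbT.
apply: ge_ereal_sup => _ [f [bf _ f0] <-]; rewrite lee_fin -(Lam_cst 0).
by apply: Lam_le => // x _; rewrite f0.
Qed.

Let le_outer_content : {homo outer_content : A B / A `<=` B >-> (A <= B)%E}.
Proof.
move=> A B AB; apply: le_ereal_inf_tmp => _ [U [oU BU] <-].
by apply: outer_content_le => //; exact: subset_trans BU.
Qed.

Let Lam_sum (F : nat -> X -> R) n : (forall i, bounded_continuous (F i)) ->
  Lam (fun x => \sum_(i < n) F i x) = \sum_(i < n) Lam (F i).
Proof.
move=> bF; elim: n => [|n IH].
  rewrite big_ord0 -[RHS](Lam_cst 0); congr Lam.
  by apply/funext => x; rewrite big_ord0.
rewrite big_ord_recr/= -IH -LamD//; last exact: bounded_continuous_sum.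
by congr Lam; apply/funext => x; rewrite big_ord_recr.
Qed.

(* A function below a union of open sets is, up to [eps] and on the compact set
   [K], below a finite sum of bumps in these sets. *)
Let open_content_sigma_subadditive (U : nat -> set X) : (forall i, open (U i)) ->
  (open_content (\bigcup_i U i) <= \sum_(i <oo) open_content (U i))%E.
Proof.
move=> oU; apply: ge_ereal_sup => _ [f [bf f01 fU] <-].
apply/lee_addgt0Pr => eps eps0.
(* The index [n] is both the number of sets and the steepness of the bumps, so [h] increases with it
   and a finite subcover of [K] reduces to one [n]. *)
pose h n x := \sum_(i < n) open_bump (U i) n x.
have bh n : bounded_continuous (h n).
  by apply: (@bounded_continuous_sum _ _ (fun i => open_bump (U i) n)) => i;
    exact: open_bump_continuous.
have h_mono m n x : (m <= n)%N -> h m x <= h n x.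
  move=> mn; rewrite /h -(big_mkord xpredT (fun i => open_bump (U i) n x)).
  rewrite (big_cat_nat (leq0n m) mn)//= big_mkord ler_wpDr//.
    by apply: sumr_ge0 => i _; exact: open_bump_ge0.
  by apply: ler_sum => i _; exact: open_bump_mono.
pose G n : set X := [set x | f x - eps < h n x].
have oG n : open (G n).
  have [cd _] : bounded_continuous (fun x => h n x + (-1) * f x).
    by apply: bounded_continuousD => //; exact: bounded_continuousZ.
  have -> : G n = (fun x => h n x + (-1) * f x) @^-1` [set t | - eps < t].
    by apply/seteqP; split=> x /=; rewrite /G /=; lra.
  by move/continuousP : cd; apply; exact: open_gt.
have KG : K `<=` \bigcup_n G n.
  move=> x _; have [[i _ Uix]|nUx] := pselect ((\bigcup_i U i) x).
    have [N NP] := open_bump_eq1 (oU i) Uix.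
    pose n := maxn i.+1 N; exists n => //; rewrite /G /= /h.
    have ni : (i < n)%N by rewrite leq_max leqnn.
    rewrite (bigD1 (Ordinal ni))//= NP ?leq_maxr//.
    have : 0 <= \sum_(j < n | j != Ordinal ni) open_bump (U j) n x.
      by apply: sumr_ge0 => j _; exact: open_bump_ge0.
    by have := f01 x; lra.
  exists 0%N => //; rewrite /G /= /h big_ord0 fU//; lra.
have [n KGn] : exists n, K `<=` G n.
  move: cK; rewrite compact_cover => /(_ nat setT G (fun n _ => oG n) KG)[D _ KD].
  exists (\max_(i <- finmap.enum_fset D) i) => x /KD[i /= iD Gix].
  by apply: lt_le_trans Gix _; apply: h_mono; exact: leq_bigmax_seq.
have Lamf : Lam f <= \sum_(i < n) Lam (open_bump (U i) n) + eps.
  have -> : \sum_(i < n) Lam (open_bump (U i) n) = Lam (h n).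
    apply/esym/(@Lam_sum (fun i => open_bump (U i) n)) => i.
    exact: open_bump_continuous.
  rewrite -[X in _ + X]Lam_cst -LamD//.
  by apply: Lam_le => [//||x /KGn]; [exact: bounded_continuousD|rewrite /G /h /=; lra].
apply: (@le_trans _ _ (\sum_(i < n) Lam (open_bump (U i) n) + eps)%:E).
  by rewrite lee_fin.
rewrite EFinD leeD2r// -sumEFin.
have nn := @nneseries_lim_ge R (fun i => open_content (U i)) xpredT 0 n
  (fun i _ _ => open_content_ge0 (U i)).
rewrite big_mkord in nn; apply: le_trans nn; apply: lee_sum => i _.
apply: Lam_below; split; first exact: open_bump_continuous.
- by move=> x; rewrite open_bump_ge0 open_bump_le1.
- by move=> x; exact: open_bump_notin.
Qed.

Let outer_content_sigma_subadditive : sigma_subadditive outer_content.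
Proof.
move=> A; apply/lee_addgt0Pr => eps eps0.
have /choice[U UP] : forall n, exists U, [/\ open U, A n `<=` U &
    (open_content U <= outer_content (A n) + (eps / (2 ^ n.+1)%:R)%:E)%E].
  move=> n; have en : 0 < eps / (2 ^ n.+1)%:R by rewrite divr_gt0// ltr0n expn_gt0.
  have [_ [U [oU AU] <-] /ltW UA] := lb_ereal_inf_adherent en (outer_content_fin (A n)).
  by exists U.
apply: le_trans (epsilon_trick xpredT (fun n => outer_content_ge0 (A n)) (ltW eps0)).
apply: (@le_trans _ _ (open_content (\bigcup_n U n))).
  apply: outer_content_le; first by apply: bigcup_open => n _; have [] := UP n.
  by move=> x [n _ Anx]; exists n => //; have [_ AU _] := UP n; exact: AU.
apply: le_trans (open_content_sigma_subadditive _) _.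
  by move=> n; have [] := UP n.
apply: lee_nneseries => [n *|n *]; first exact: open_content_ge0.
by have [] := UP n.
Qed.

Let om : {outer_measure set X -> \bar R} :=
  HB.pack outer_content (isOuterMeasure.Build R X outer_content outer_content0
    outer_content_ge0 le_outer_content outer_content_sigma_subadditive).

(** Let [f] be nearly optimal below [G] intersected with [U]. The rest of [G] lies in the open set
    [V] where [f < eps / 2]. Cutting [f] down to the positive part of [f - eps / 2] makes it vanish
    on [V], so any [h] below [V] can be added to it while staying below [G]. *)
Let caratheodory_open U : open U -> om.-caratheodory U.
Proof.
move=> oU; apply: le_caratheodory_measurable => A.
apply: le_ereal_inf_tmp => _ [G [oG AG] <-].
apply: (@le_trans _ _ (open_content (G `&` U) + outer_content (G `&` ~` U))%E).
  apply: leeD; last by apply: le_outer_content; exact: setSI.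
  by apply: outer_content_le; [exact: openI|exact: setSI].
rewrite -(fineK (open_content_fin (G `&` U))) -(fineK (outer_content_fin (G `&` ~` U))).
rewrite -(fineK (open_content_fin G)) -EFinD lee_fin.
apply/ler_addgt0Pr => eps eps0; have e2 : 0 < eps / 2 by rewrite divr_gt0.
have [_ [f [bf f01 fGU] <-]] := ub_ereal_sup_adherent e2 (open_content_fin (G `&` U)).
rewrite -/(open_content _) -(fineK (open_content_fin (G `&` U))) -EFinB lte_fin => Lf.
pose V := G `&` [set x | f x < eps / 2].
have oV : open V.
  apply: openI => //; have [cf _] := bf.
  by move/continuousP : cf => /(_ [set t | t < eps / 2]); apply; exact: open_lt.
have GUV : G `&` ~` U `<=` V.
  by move=> x [Gx nUx]; split=> //=; rewrite fGU// => -[].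
suff : (open_content V <= (fine (open_content G) - Lam f + eps / 2)%:E)%E.
  move/(le_trans (outer_content_le oV GUV)).
  by rewrite -(fineK (outer_content_fin _)) lee_fin; lra.
apply: ge_ereal_sup => _ [h [bh h01 hV] <-]; rewrite lee_fin.
pose f' x := Num.max (f x + (- (eps / 2))) 0.
have bfe : bounded_continuous (fun x => f x + (- (eps / 2))).
  by apply: bounded_continuousD => //; exact: bcst.
have bf' : bounded_continuous f' by apply: bounded_continuous_max => //; exact: bcst.
have f'P x : 0 <= f' x /\ f x - eps / 2 <= f' x.
  by rewrite /f'; have [] := leP (f x + (- (eps / 2))) 0; lra.
have f'_le x : f' x <= f x.
  by have := f01 x; rewrite /f'; have [] := leP (f x + (- (eps / 2))) 0; lra.
have f'0 x : f x < eps / 2 -> f' x = 0.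
  by rewrite /f'; have [] := leP (f x + (- (eps / 2))) 0; lra.
have Lf' : Lam f - eps / 2 <= Lam f'.
  rewrite -[X in _ - X]Lam_cst -mulN1r -LamZ// -LamD//; last exact: bounded_continuousZ.
  apply: Lam_le => //; first by apply: bounded_continuousD => //; exact: bounded_continuousZ.
  by move=> x _; have [_] := f'P x; rewrite mulN1r.
have : ((Lam (fun x => f' x + h x))%:E <= open_content G)%E.
  apply: Lam_below; split; first exact: bounded_continuousD.
    move=> x; have := f01 x; have := h01 x; have [] := f'P x; have := f'_le x.
    have [[_ /f'0 ->]|nVx] := pselect (V x); first by lra.
    by rewrite (hV _ nVx); lra.
  move=> x nGx; have -> : h x = 0 by apply: hV => -[].
  rewrite addr0 f'0// fGU// => -[//].
rewrite LamD// -(fineK (open_content_fin G)) lee_fin; lra.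
Qed.

Let borel_caratheodory (A : set (borel X)) : measurable A -> om.-caratheodory A.
Proof.
have sa : sigma_algebra setT (om.-caratheodory).
  exact: (@sigma_algebra_measurable _ (caratheodory_type om)).
move: A; apply: smallest_sub => // U oU; exact: caratheodory_open.
Qed.

Let content0 : outer_content (set0 : set (borel X)) = 0%E.
Proof. exact: outer_content0. Qed.

Let content_sigma_additive :
  semi_sigma_additive (outer_content : set (borel X) -> \bar R).
Proof.
move=> F mF tF mUF.
apply: (@measure_semi_sigma_additive _ (caratheodory_type om) R om) => //.
- by move=> i; exact: borel_caratheodory.
- exact: borel_caratheodory.
Qed.

Let contentT : outer_content [set: borel X] = 1%E.
Proof.
rewrite outer_content_open; last exact: openT.
apply/eqP; rewrite eq_le open_content_le1 -Lam1; apply: Lam_below.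
by split=> [|x|x []//]; [exact: bcst|rewrite ler01 lexx].
Qed.

Let mu0 : measure (borel X) R :=
  HB.pack (outer_content : set (borel X) -> \bar R)
   (isMeasure.Build _ (borel X) R outer_content content0 outer_content_ge0
      content_sigma_additive).

Let mu : probability (borel X) R :=
  HB.pack (outer_content : set (borel X) -> \bar R)
   (isMeasure.Build _ (borel X) R outer_content content0 outer_content_ge0
      content_sigma_additive) (Measure_isProbability.Build _ (borel X) R mu0 contentT).

(** Layer cake: [f] is the sum of slices [F k] of height [N], and [F k / N] is below the superlevel
    set [G k], so [Lam (F k)] is at most [N] times the measure of [G k]. Conversely the indicators
    of the [G k], times [N], sum to at most [f + N]. *)
Let Lam_le_mean f : bounded_continuous f -> (forall x, 0 <= f x <= 1) ->
  Lam f <= \int[mu]_x f x.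
Proof.
move=> bf f01; apply/ler_addgt0Pr => eps eps0.
have [n neps] := small_invS eps0; set N := n.+1%:R^-1 in neps.
have N0 : 0 < N by rewrite invr_gt0.
have nN : n.+1%:R * N = 1 by rewrite divff.
pose F k x := Num.min N (Num.max (f x + - (k%:R * N)) 0).
have bF k : bounded_continuous (F k).
  apply: bounded_continuous_min; first exact: bcst.
  apply: bounded_continuous_max; last exact: bcst.
  by apply: bounded_continuousD => //; exact: bcst.
pose G k : set (borel X) := [set x | k%:R * N < f x].
have oG k : open (G k : set X).
  have [/continuousP/(_ [set t | k%:R * N < t]) cf _] := bf.
  by apply: cf; exact: open_gt.
have mG k : measurable (G k) by exact: (@borel_open R X).
have trunc (a b : R) :
    Num.min a b + Num.min N (Num.max (a + - b) 0) = Num.min a (b + N).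
  have [ab|ba] := leP a b.
    rewrite max_r; last by lra.
    by rewrite min_r ?(ltW N0)// addr0 min_l//; lra.
  rewrite max_l; last by lra.
  by have [h|h] := leP a (b + N); [rewrite min_r; lra|rewrite min_l; lra].
have Fsum x : forall m, f x <= m%:R * N -> f x = \sum_(k < m) F k x.
  move=> m; have telesc j : \sum_(k < j) F k x = Num.min (f x) (j%:R * N).
    elim: j => [|j IH]; first by rewrite big_ord0 mul0r min_r//; have /andP[] := f01 x.
    rewrite big_ord_recr/= IH /F -[in RHS]natr1 mulrDl mul1r.
    exact: trunc.
  by rewrite telesc => h; rewrite min_l.
have LF k : Lam (F k) <= N * fine (mu (G k)).
  have NN : N * n.+1%:R = 1 by rewrite mulrC.
  suff : Lam (fun x => n.+1%:R * F k x) <= fine (mu (G k)).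
    by rewrite LamZ// -(ler_pM2l N0) mulrA NN mul1r.
  rewrite -lee_fin fineK; last exact: fin_num_measure.
  rewrite [leRHS]outer_content_open//; apply: Lam_below; split.
  - exact: bounded_continuousZ.
  - move=> x; have Fx : 0 <= F k x <= N.
      by rewrite /F le_min ge_min lexx (ltW N0) le_max lexx orbT.
    case/andP: Fx => F0 FN; rewrite mulr_ge0//= -[leRHS]nN.
    by rewrite ler_wpM2l.
  - move=> x /negP; rewrite /G /= -leNgt => fx.
    rewrite /F max_r; last by lra.
    by rewrite min_r ?mulr0// ltW.
have bI k : bounded_measurable (fun x : borel X => N * (\1_(G k) x : R)).
  by apply: bounded_measurableZ; exact: bounded_measurable_indic.
have bsum m : bounded_measurable (fun x : borel X => \sum_(k < m) N * (\1_(G k) x : R)).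
  elim: m => [|m IH].
    have -> : (fun x : borel X => \sum_(k < 0) N * (\1_(G k) x : R)) = cst 0.
      by apply/funext => x; rewrite big_ord0.
    exact: bounded_measurable_cst.
  have -> : (fun x : borel X => \sum_(k < m.+1) N * (\1_(G k) x : R)) =
      (fun x => \sum_(k < m) N * (\1_(G k) x : R) + N * (\1_(G m) x : R)).
    by apply/funext => x; rewrite big_ord_recr.
  exact: bounded_measurableD.
have mean_sum m : \int[mu]_x (\sum_(k < m) N * (\1_(G k) x : R)) =
    \sum_(k < m) N * fine (mu (G k)).
  elim: m => [|m IH].
    rewrite big_ord0 -[RHS](mean_cst mu); apply: eq_Rintegral => x _.
    by rewrite big_ord0.
  rewrite big_ord_recr/= -IH.
  have -> : fine (mu (G m)) = \int[mu]_x (\1_(G m) x : R).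
    by apply: EFin_inj; rewrite fineK ?fin_num_measure//; exact/esym/mean_indic.
  rewrite -meanZ; last exact: bounded_measurable_indic.
  rewrite -meanD//; apply: eq_Rintegral => x _.
  by rewrite big_ord_recr.
have -> : Lam f = \sum_(k < n.+1) Lam (F k).
  rewrite -Lam_sum//; congr Lam; apply/funext => x; apply: Fsum.
  by rewrite nN; have /andP[] := f01 x.
apply: (@le_trans _ _ (\int[mu]_x (\sum_(k < n.+1) N * (\1_(G k) x : R)))).
  by rewrite mean_sum; apply: ler_sum => k _; exact: LF.
have bfm := bounded_continuous_measurable bf.
rewrite -[X in _ + X](mean_cst mu) -meanD//; last exact: bounded_measurable_cst.
apply: le_mean => //; first by apply: bounded_measurableD => //; exact: bounded_measurable_cst.
move=> x; apply: (@le_trans _ _ (f x + N)); last by rewrite lerD2l ltW.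
have : forall j, \sum_(k < j) N * (\1_(G k) x : R) <= f x + N; last exact.
elim=> [|m IH].
  by rewrite big_ord0; have := f01 x; lra.
rewrite big_ord_recr/= indicE.
have [/set_mem Gx|_] := boolP (x \in G m); last by rewrite mulr0 addr0.
have : \sum_(k < m) N * (\1_(G k) x : R) <= m%:R * N.
  rewrite mulr_natl -[m in leRHS]card_ord -sumr_const; apply: ler_sum => k _.
  by rewrite ler_piMr ?(ltW N0)// indicE; case: (_ \in _).
by move: Gx; rewrite /G /= mulr1; lra.
Qed.

(** A function below the complement of [K] vanishes on [K], so [Lam_le] gives that complement
    measure zero. For the integral formula, [Lam_le_mean] applied to [f] and to [1 - f] gives both
    inequalities. *)
Lemma riesz_compact : exists nu : probability (borel X) R,
  nu K = 1%E /\ forall f, bounded_continuous f -> \int[nu]_x f x = Lam f.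
Proof.
exists mu; split.
  have oCK : open (~` K).
    exact/closed_openC/(compact_closed (metric_hausdorff (T := X))).
  have mCK : measurable (~` K : set (borel X)) by exact: (@borel_open R X).
  rewrite -(setCK K) probability_setC//.
  suff -> : mu (~` K) = 0%E by rewrite sube0.
  rewrite [LHS]outer_content_open//; apply/eqP; rewrite eq_le open_content_ge0 andbT.
  apply: ge_ereal_sup => _ [f [bf f01 fK] <-]; rewrite lee_fin -(Lam_cst 0).
  by apply: Lam_le => // x Kx; rewrite fK//=; exact.
suff unit f : bounded_continuous f -> (forall x, 0 <= f x <= 1) ->
    \int[mu]_x f x = Lam f.
  move=> f [cf [M fM]]; have bf : bounded_continuous f by split=> //; exists M.
  have M1 : 0 < 2 * (`|M| + 1) by rewrite mulr_gt0// ltr_wpDl.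
  (* An affine change of [f] with values in [[0, 1]]; both functionals respect it. *)
  pose u x := 2^-1 + (2 * (`|M| + 1))^-1 * f x.
  have bu : bounded_continuous u.
    by apply: bounded_continuousD; [exact: bcst|exact: bounded_continuousZ].
  have fm := bounded_continuous_measurable bf.
  have u01 x : 0 <= u x <= 1.
    have := fM x; have := ler_norm M; rewrite ler_norml => MM fMx.
    have : `|(2 * (`|M| + 1))^-1 * f x| <= 2^-1.
      rewrite normrM gtr0_norm ?invr_gt0// mulrC ler_pdivrMr//.
      by rewrite ler_norml; lra.
    by rewrite ler_norml /u; lra.
  have := unit u bu u01; rewrite /u meanD ?mean_cst ?meanZ//; last 2 first.
  - exact: bounded_measurable_cst.
  - exact: bounded_measurableZ.
  rewrite LamD ?LamZ//; [|exact: bcst|exact: bounded_continuousZ].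
  rewrite Lam_cst => /addrI/mulfI; apply.
  by rewrite invr_eq0 gt_eqF.
move=> bf f01; apply/eqP; rewrite eq_le Lam_le_mean// andbT.
have bf' : bounded_continuous (fun x => 1 + (-1) * f x).
  by apply: bounded_continuousD; [exact: bcst|exact: bounded_continuousZ].
have := Lam_le_mean bf' _.
rewrite LamD ?LamZ//; [|exact: bcst|exact: bounded_continuousZ].
have fm := bounded_continuous_measurable bf.
rewrite meanD ?mean_cst ?meanZ//; last 2 first.
- exact: bounded_measurable_cst.
- exact: bounded_measurableZ.
rewrite Lam_cst !mulN1r lerD2l lerN2; apply.
by move=> x; have := f01 x; lra.
Qed.

End riesz.

(** * Stationary measure *)

Lemma mean_bounded_cvg {d : measure_display} {T : measurableType d}
    {R : realType} (mu : probability T R) (f : nat -> T -> R) (g : T -> R) (M : R) :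
  (forall n, bounded_measurable (f n)) -> bounded_measurable g ->
  (forall n x, `|f n x| <= M) -> (forall x, f n x @[n --> \oo] --> g x) ->
  \int[mu]_x f n x @[n --> \oo] --> \int[mu]_x g x.
Proof.
move=> bf bg fM fg.
have [|||||_ _ h] := @dominated_convergence _ _ _ mu setT measurableT
  (fun n => EFin \o f n) (EFin \o g) (EFin \o cst M).
- by move=> n; apply/measurable_EFinP; have [] := bf n.
- by apply/measurable_EFinP; case: bg.
- apply: aeW => x _; apply: cvg_EFin; last exact: fg.
  exact: nearW.
- by apply: bounded_measurable_integrable; exact: bounded_measurable_cst.
- by apply: aeW => x n _; rewrite /= lee_fin.
move: h; rewrite -EFin_mean// => /fine_cvgP[_].
by apply: cvg_trans; apply: near_eq_cvg; apply: nearW => n.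
Qed.

Section lipschitz_determine.
Context {R : realType} {X : polishType R}.

(** The two bounds are imposed separately, not on their sum, so this class contains the unit ball of
    [lip_norm]. *)
Definition lipschitz1 (f : X -> R) : Prop :=
  (forall x, `|f x| <= 1) /\ (forall x y, `|f x - f y| <= mdist x y).

Lemma lipschitz1_bounded_continuous f : lipschitz1 f -> bounded_continuous f.
Proof.
move=> [f1 fL]; split; last by exists 1.
by apply: (@lipschitz_continuous _ _ 1) => x y; rewrite mul1r.
Qed.

(** Rescaled bumps belong to the class and their unscaled limits are indicators of open sets, which
    form a generating family stable under intersection. *)
Lemma eq_probability_lipschitz1 (mu nu : probability (borel X) R) :
  (forall f, lipschitz1 f -> \int[mu]_x f x = \int[nu]_x f x) ->
  forall A, measurable A -> mu A = nu A.
Proof.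
move=> munu A mA.
have eq_open (U : set X) : open U -> mu (U : set (borel X)) = nu (U : set (borel X)).
  move=> oU; have mU := borel_open oU.
  have bump_cvg (m : probability (borel X) R) :
      \int[m]_x open_bump U n x @[n --> \oo] --> \int[m]_x (\1_U x : R).
    apply: (@mean_bounded_cvg _ _ _ m (open_bump U) _ 1) => [n||n x|x].
    - exact/bounded_continuous_measurable/open_bump_continuous.
    - exact: bounded_measurable_indic.
    - by rewrite ger0_norm ?open_bump_ge0// open_bump_le1.
    - exact: open_bump_cvg.
  rewrite -!(mean_indic _ mU); congr (_%:E).
  apply: (cvg_unique (@norm_hausdorff _ R^o) (bump_cvg mu)).
  have -> : (fun n => \int[mu]_x open_bump U n x) = (fun n => \int[nu]_x open_bump U n x).
    apply/funext => n.
    (* Dividing by [n.+1] and not by the Lipschitz constant [n] covers [n = 0] and keeps the bump at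
       most 1. *)
    have n0 : (0 : R) < n.+1%:R by [].
    have scale (m : probability (borel X) R) : \int[m]_x open_bump U n x =
        n.+1%:R * \int[m]_x (n.+1%:R^-1 * open_bump U n x).
      rewrite meanZ ?mulVKf ?gt_eqF//.
      exact/bounded_continuous_measurable/open_bump_continuous.
    rewrite !scale munu//; split=> [x|x y].
      rewrite normrM ger0_norm ?invr_ge0// mulrC ler_pdivrMr// mul1r.
      rewrite ger0_norm ?open_bump_ge0// (le_trans (open_bump_le1 _ _ _))//.
      by rewrite ler1n.
    rewrite -mulrBr normrM ger0_norm ?invr_ge0// mulrC ler_pdivrMr//.
    rewrite (le_trans (open_bump_lipschitz _ _ _ _))// mulrC ler_wpM2l ?mdist_ge0//.
    by rewrite ler_nat.
  exact: bump_cvg.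
apply: (@measure_unique _ _ (borel X) (@open X : set (set (borel X))) (fun=> setT)) => //.
- by move=> U U'; exact: openI.
- by move=> _; exact: openT.
- by rewrite bigcup_const//; exists 0%N.
- by move=> _; rewrite (le_lt_trans (probability_le1 _ _)) ?ltry.
Qed.

End lipschitz_determine.

Section ultralimit.
Context {R : realType}.

Lemma ultra_fmap {T U : Type} (F : set_system T) (u : T -> U) :
  UltraFilter F -> UltraFilter (u @ F).
Proof.
move=> FU; apply: Build_UltraFilter => G GP FG.
apply/seteqP; split=> A; last exact: FG.
move=> GA; have [//|nFA] := in_ultra_setVsetC (u @^-1` A) FU.
have GN : G (A `&` ~` A) by apply: filterI => //; exact: FG.
by have [x []] := filter_ex GN.
Qed.

Lemma cvg_ultra_bounded (F : set_system nat) (u : nat -> R) M :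
  UltraFilter F -> (forall n, `|u n| <= M) -> exists l : R, u n @[n --> F] --> l.
Proof.
move=> FU uM; have := @segment_compact R (- M) M; rewrite compact_ultra.
move=> /(_ _ (ultra_fmap u FU)) [|l [_ ul]]; last by exists l.
have -> : (u @ F) `[- M, M]%classic = F (u @^-1` `[- M, M]%classic) by [].
have -> : u @^-1` `[- M, M]%classic = setT; last exact: filterT.
by apply/seteqP; split=> // n _; rewrite /= in_itv/= -ler_norml.
Qed.

End ultralimit.

Section stationary.
Context {R : realType} {X Z : polishType R} (S : X -> Z -> X).
Variables (l : probability (borel Z) R) (K : set X) (E : set Z).
Hypothesis LS : locally_lipschitz S.
Hypothesis cE : compact E.
Hypothesis mE : measurable (E : set (borel Z)).
Hypothesis lE : l E = 1%E.
Hypothesis SK : forall x z, K x -> E z -> K (S x z).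
Hypothesis cK : compact K.

Local Notation T := (markov_op S l).

Let cS : continuous (fun p : X * Z => S p.1 p.2).
Proof. exact: locally_lipschitz_continuous. Qed.

Lemma mbounded_setX (A : set X) (B : set Z) : mbounded A -> mbounded B ->
  mbounded (A `*` B).
Proof.
move=> [x [M AM]] [z [N BN]]; exists (x, z), (Num.max M N) => -[y w] [/= Ay Bw].
split=> /=.
  by apply: le_ball (AM _ Ay); rewrite le_max lexx.
by apply: le_ball (BN _ Bw); rewrite le_max lexx orbT.
Qed.

Lemma compact_mbounded (B : set Z) : compact B -> mbounded B.
Proof.
move=> cB; have [x [M BM]] := mbounded_neighborhood 0 cB.
exists x, M => y By; apply: BM => /=; rewrite -(mdistxx y).
by apply: ereal_inf_lbound; exists y.
Qed.

Lemma step_lipschitz (A : set X) : mbounded A ->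
  exists2 L, 0 <= L & forall x y z, A x -> A y -> E z ->
    mdist (S x z) (S y z) <= L * mdist x y.
Proof.
move=> bA; have [L SL] := LS (mbounded_setX bA (compact_mbounded cE)).
exists `|L| => // x y z Ax Ay Ez.
have := SL (x, z) (y, z) (conj Ax Ez) (conj Ay Ez); rewrite /= mdistxx.
rewrite max_l ?mdist_ge0// => /le_trans; apply.
by rewrite ler_wpM2r ?mdist_ge0// ler_norm.
Qed.

(** The Riesz formula concerns continuous functions only, and stationarity requires it for [T f].
    Near a given point [S] is Lipschitz uniformly over noise in [E], and [T f] inherits this. *)
Lemma markov_op_lipschitz1_continuous f : lipschitz1 f ->
  bounded_continuous (T f : X -> R).
Proof.
move=> f1; have bf := bounded_continuous_measurable (lipschitz1_bounded_continuous f1).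
split; last first.
  exists 1 => x; apply: norm_mean_le.
    exact: (bounded_measurable_step cS (f := f) x bf).
  by move=> z; case: f1.
move=> x; apply/cvgrPdist_lt => eps eps0.
have [|L L0 SL] := @step_lipschitz (ball x 1); first by exists x, 1.
have e0 : 0 < Num.min 1 (eps / (L + 1)).
  by rewrite lt_min ltr01 divr_gt0// ltr_wpDl.
have := nbhsx_ballx x _ e0; apply: filterS => y xy.
have xy1 : ball x 1 y by apply: le_ball xy; rewrite ge_min lexx.
apply: (@le_lt_trans _ _ (L * mdist x y)).
  apply: (dist_mean2_full mE lE) => [||z Ez].
  - exact: (bounded_measurable_step cS (f := f) x bf).
  - exact: (bounded_measurable_step cS (f := f) y bf).
  have [_ fL] := f1; rewrite (le_trans (fL _ _))//.
  by apply: SL => //; exact: ballxx.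
move: xy; rewrite ballEmdist /= lt_min ltr_pdivlMr ?ltr_wpDl// => /andP[_].
by have := mdist_ge0 x y; lra.
Qed.

(** Riesz representation needs a functional on all bounded continuous functions, while [asym] speaks
    of Lipschitz ones; an ultralimit exists for every bounded sequence. By [asym] it takes the same
    value at [T f] and [f] for Lipschitz [f], which suffices to identify the law after one step with
    [mu]. *)
Lemma stationary_measure x0 : K x0 ->
  (forall f, lipschitz1 f ->
     iter n.+1 T f x0 - iter n T f x0 @[n --> \oo] --> (0 : R)) ->
  exists mu : probability (borel X) R,
    mu K = 1%E /\ forall f, bounded_measurable f ->
      \int[mu]_x T f x = \int[mu]_x f x.
Proof.
move=> Kx0 asym.
have [F [FU ooF]] := ultraFilterLemma (eventually_filter : ProperFilter \oo).
pose Lam (f : X -> R) : R := lim (iter n T f x0 @[n --> F]).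
have LamP (f : X -> R) : bounded_continuous f -> iter n T f x0 @[n --> F] --> Lam f.
  move=> bf; have [_ [M fM]] := bf.
  have [|a ha] := @cvg_ultra_bounded _ F (fun n => iter n T f x0) M FU.
    move=> n; apply: norm_iter_markov_op_le => //.
    exact: bounded_continuous_measurable.
  by apply/cvg_ex; exists a.
have Lam_unique (f : X -> R) a : iter n T f x0 @[n --> F] --> a -> Lam f = a.
  by move=> ha; apply: cvg_lim => //; exact: norm_hausdorff.
have affine (f : X -> R) a b : bounded_continuous f ->
    (fun n => iter n T (fun x => a + b * f x) x0) = (fun n => a + b * iter n T f x0).
  move=> bf; apply/funext => n; apply: iter_markov_op_affine => //.
  exact: bounded_continuous_measurable.
have iterD f g n : bounded_measurable f -> bounded_measurable g ->
    forall x, iter n T (fun x => f x + g x) x = iter n T f x + iter n T g x.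
  move=> bf bg; elim: n => //= n IH x; rewrite /markov_op.
  have bn h : bounded_measurable h ->
      bounded_measurable (fun z : borel Z => iter n T h (S x z)).
    by move=> bh; apply: bounded_measurable_step => //; exact: bounded_measurable_iter_markov_op.
  rewrite -meanD; [|exact: bn..].
  by apply: eq_Rintegral => z _; rewrite IH.
have [||||mu [muK muE]] := @riesz_compact R X K Lam cK.
- move=> f g bf bg; apply: Lam_unique.
  have -> : (fun n => iter n T (fun x => f x + g x) x0) =
      (fun n => iter n T f x0 + iter n T g x0).
    by apply/funext => n; apply: iterD; exact: bounded_continuous_measurable.
  by apply: cvgD; exact: LamP.
- move=> c f bf; apply: Lam_unique.
  have := affine f 0 c bf.
  have -> : (fun x => 0 + c * f x) = (fun x => c * f x) by apply/funext => x; rewrite add0r.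
  move=> ->; rewrite -[c * Lam f]add0r; apply: cvgD; first exact: cvg_cst.
  by apply: cvgM; [exact: cvg_cst|exact: LamP].
- apply: Lam_unique.
  have -> : (fun n => iter n T (cst 1) x0) = cst 1; last exact: cvg_cst.
  have := affine (cst 0) 1 0 (bounded_continuous_cst 0).
  have -> : (fun x : X => 1 + 0 * cst 0 x) = cst 1 :> (X -> R).
    by apply/funext => x; rewrite mul0r addr0.
  by move=> ->; apply/funext => n; rewrite mul0r addr0.
- move=> f g bf bg fg; apply: ler_cvg_to (LamP f bf) (LamP g bg) _.
  apply: nearW => n; apply: (le_iter_markov_op cS mE lE SK) => //;
    exact: bounded_continuous_measurable.
exists mu; split=> //.
pose mu1 := image_probability (mu \x l)%E (measurable_step cS).
have mean_mu1 f : bounded_measurable f -> \int[mu1]_x f x = \int[mu]_x T f x.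
  move=> bf; rewrite mean_image_probability//.
  exact: (mean_fubini mu l (bounded_measurable_comp (measurable_step cS) bf)).
have eq_mu : forall A, measurable A -> mu1 A = mu A.
  apply: eq_probability_lipschitz1 => f f1.
  have bcf := lipschitz1_bounded_continuous f1.
  rewrite mean_mu1; last exact: bounded_continuous_measurable.
  rewrite !muE//; last exact: markov_op_lipschitz1_continuous.
  apply: Lam_unique.
  have -> : (fun n => iter n T (T f) x0) =
      (fun n => (iter n.+1 T f x0 - iter n T f x0) + iter n T f x0).
    by apply/funext => n; rewrite subrK iterSr.
  rewrite -[Lam f]add0r; apply: cvgD; last exact: LamP.
  by apply: cvg_trans (asym f f1); exact: cvg_app.
by move=> f bf; rewrite -mean_mu1//; exact: eq_measure_mean.
Qed.

End stationary.

(** * Rate of convergence *)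

Lemma geometric_exponential {R : realType} (q : R) (m : nat) :
  0 <= q -> q < 1 -> (0 < m)%N ->
  exists C b : R, [/\ 0 < C, 0 < b &
    forall n, q ^+ (n %/ m) <= C * expR (- b * n%:R)].
Proof.
(* Since [q] may be 0, it is replaced by a positive [p] with a genuine logarithm. The constant
   [1 / p] pays for rounding [n / m] down. *)
move=> q0 q1 m0; pose p := Num.max q 2^-1.
have p0 : 0 < p by rewrite lt_max invr_gt0 ltr0n orbT.
have p1 : p < 1 by rewrite gt_max q1 invf_lt1// ltr1n.
have a0 : 0 < - ln p by rewrite oppr_gt0 ln_lt0// p0.
have mR : 0 < m%:R :> R by rewrite ltr0n.
exists (expR (- ln p)), (- ln p / m%:R); split; [exact: expR_gt0|exact: divr_gt0|].
move=> n; apply: (@le_trans _ _ (p ^+ (n %/ m))).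
  by apply: lerXn2r; rewrite ?nnegrE ?(ltW p0)// le_max lexx.
rewrite -[p in leLHS]lnK; last by rewrite posrE.
rewrite -expRM_natl -expRD ler_expR.
have nm : n%:R / m%:R <= (n %/ m)%:R + 1 :> R.
  by rewrite ler_pdivrMr// natr1 -natrM ler_nat ltnW// ltn_ceil.
have := ler_wpM2l (ltW a0) nm.
have -> : - (- ln p / m%:R) * n%:R = - (- ln p * (n%:R / m%:R)) by ring.
by lra.
Qed.

(** Used with [a = ln L], [k = kappa] and [t] the number of steps spent approaching [Y]: decay over
    [t >= s j] steps beats the expansion [L^j] with an exponent [j] to spare. *)
Lemma split_exponent {R : realFieldType} (a k s t j b : R) :
  0 <= k -> 0 <= j -> a + 1 <= k * s -> s * j <= t -> b <= 1 ->
  j * a + - k * t <= - (b * j).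
Proof.
move=> k0 j0 /(ler_wpM2r j0) h1 /(ler_wpM2l k0) h2 /(ler_wpM2r j0) h3.
by lra.
Qed.

Lemma split_bound {R : realFieldType} (v e c w w' : R) :
  1 <= v -> 0 <= c -> 0 <= e -> w <= e -> w' <= e ->
  2 * v * w + c * w' <= (2 + c) * e * v.
Proof.
move=> v1 c0 e0 we w'e; have v0 : 0 <= v by lra.
have h1 := ler_wpM2l v0 we; have h2 := ler_wpM2l c0 w'e.
have h3 := ler_wpM2l (mulr_ge0 c0 e0) v1.
by lra.
Qed.

Section rate.
Context {R : realType} {X Z : polishType R} (S : X -> Z -> X).
Variables (l : probability (borel Z) R) (K : set X) (E : set Z).
Variables (Y : set X) (V : X -> R).
Hypothesis LS : locally_lipschitz S.
Hypothesis cE : compact E.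
Hypothesis mE : measurable (E : set (borel Z)).
Hypothesis lE : l E = 1%E.
Hypothesis cK : compact K.
Hypothesis YK : Y `<=` K.
Hypothesis acY : asymptotic_compactness S E Y V.

Local Notation T := (markov_op S l).

Let cS : continuous (fun p : X * Z => S p.1 p.2).
Proof. exact: locally_lipschitz_continuous. Qed.

Let E_nonempty : exists z, E z.
Proof.
apply: contrapT => nE; move: lE; suff -> : E = set0.
  by rewrite measure0 => /eqP; rewrite eqe eq_sym oner_eq0.
by apply/seteqP; split=> // z Ez; apply: nE; exists z.
Qed.

(** Asymptotic compactness bounds every trajectory with noise in [E]; this turns such a
    deterministic bound into one on [T^k]. The induction frees the last noise, which lies in [E]
    almost surely. *)
Lemma iter_markov_op_trajectory k (h : borel X -> R) c M x :
  bounded_measurable h ->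
  (forall zeta, (forall i, E (zeta i)) -> `|h (Defs.iterS S k x zeta) - c| <= M) ->
  `|iter k T h x - c| <= M.
Proof.
move=> bh hM; have [z0 Ez0] := E_nonempty; elim: k h bh hM => [|k IH] h bh hM.
  exact: (hM (fun=> z0)).
rewrite iterSr; apply: IH; first exact: bounded_measurable_markov_op.
move=> zeta Ezeta; apply: (dist_mean_full mE lE).
  exact: (bounded_measurable_step cS (f := h) _ bh).
move=> z Ez; have := hM (fun i => if (i < k)%N then zeta i else z).
rewrite /= ltnn (@iterS_ext _ _ S k x _ zeta); last by move=> i ->.
by apply=> i; case: ifP.
Qed.

(** [V] is bounded by [M] on the unit neighbourhood of [Y], so trajectories started there stay in
    the bounded set [D], where a single Lipschitz constant of [S] is valid for all noise in [E].
    Driving both points by the same noise costs one factor per step. *)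
Lemma synchronous_lipschitz : exists2 L, 1 <= L &
  forall f j y y', lipschitz1 f -> (dist_to y Y <= 1)%E -> Y y' ->
    `|iter j T f y - iter j T f y'| <= L ^+ j * mdist y y'.
Proof.
have [cY _ V0 bV [kappa k0 acS]] := acY.
have [M VM] := bV _ (mbounded_neighborhood 1 cY).
pose D := [set x : X | (dist_to x Y <= (Num.max 1 M)%:E)%E].
have [L L0 SL] := step_lipschitz LS cE (mbounded_neighborhood (Num.max 1 M) cY).
(* Being within 1 of [Y] need not survive a step, but having its whole future in [D] does; the
   induction carries this property. *)
pose good y := forall n zeta, (forall i, E (zeta i)) -> D (Defs.iterS S n y zeta).
have good1 y : (dist_to y Y <= 1)%E -> good y.
  move=> yY [|n] zeta Ezeta; first by rewrite /D /= (le_trans yY)// lee_fin le_max lexx.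
  rewrite /D /=; apply: le_trans (acS y zeta n.+1 Ezeta isT) _.
  rewrite lee_fin le_max; apply/orP; right; apply: le_trans (VM y yY).
  by rewrite ler_piMr// -expR0 ler_expR mulNr oppr_le0 mulr_ge0// ltW.
have goodS y z : good y -> E z -> good (S y z).
  move=> gy Ez n zeta Ezeta.
  have := gy n.+1 (fun i => if i is j.+1 then zeta j else z).
  by rewrite -iterS_shift; apply=> -[|i].
exists (Num.max 1 L); first by rewrite le_max lexx.
set L1 := Num.max 1 L.
have L10 : 0 <= L1 by rewrite le_max ler01.
move=> f j y y' f1 yY Yy'.
have y'Y : (dist_to y' Y <= 1)%E.
  apply: ge_ereal_inf; exists (mdist y' y')%:E; first by exists y'.
  by rewrite mdistxx lee_fin.
move: (good1 y yY) (good1 y' y'Y) => {yY Yy' y'Y}.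
have [_ fL] := f1.
have bf := bounded_continuous_measurable (lipschitz1_bounded_continuous f1).
elim: j y y' => [|j IH] y y' gy gy' /=; first by rewrite expr0 mul1r.
have [z0 Ez0] := E_nonempty.
have bj : bounded_measurable (iter j T f) by exact: bounded_measurable_iter_markov_op.
apply: (dist_mean2_full mE lE) => [||z Ez].
- exact: (bounded_measurable_step cS (f := iter j T f) y bj).
- exact: (bounded_measurable_step cS (f := iter j T f) y' bj).
rewrite (le_trans (IH _ _ (goodS _ _ gy Ez) (goodS _ _ gy' Ez)))//.
rewrite exprSr -mulrA ler_wpM2l ?exprn_ge0//.
have Dy : D y := gy 0%N (fun=> z0) (fun=> Ez0).
have Dy' : D y' := gy' 0%N (fun=> z0) (fun=> Ez0).
rewrite (le_trans (SL _ _ _ Dy Dy' Ez))// ler_wpM2r ?mdist_ge0//.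
by rewrite le_max lexx orbT.
Qed.

Variables (C0 b : R).
Hypotheses (C00 : 0 <= C0) (b0 : 0 < b).
Hypothesis mixing : forall f n x y, lipschitz1 f -> K x -> K y ->
  `|iter n T f x - iter n T f y| <= C0 * expR (- b * n%:R).

Variable mu : probability (borel X) R.
Hypothesis muK : mu K = 1%E.
Hypothesis mu_stationary : forall f, bounded_measurable f ->
  \int[mu]_x T f x = \int[mu]_x f x.

Lemma mean_iter_markov_op n (f : borel X -> R) : bounded_measurable f ->
  \int[mu]_x iter n T f x = \int[mu]_x f x.
Proof.
move=> bf; elim: n => //= n IH.
by rewrite mu_stationary//; exact: bounded_measurable_iter_markov_op.
Qed.

Lemma mixing_mean f n y : lipschitz1 f -> K y ->
  `|iter n T f y - \int[mu]_x f x| <= C0 * expR (- b * n%:R).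
Proof.
move=> f1 Ky.
have bf := bounded_continuous_measurable (lipschitz1_bounded_continuous f1).
rewrite -(mean_iter_markov_op n bf) distrC.
have mK : measurable (K : set (borel X)).
  apply: (@borel_closed R X); exact: compact_closed (metric_hausdorff (T := X)) cK.
apply: (dist_mean_full mK muK) => [|x Kx]; last exact: mixing.
exact: bounded_measurable_iter_markov_op.
Qed.

Lemma pointwise_rate : exists C beta : R, [/\ 0 < C, 0 < beta &
  forall f x n, lipschitz1 f ->
    `|iter n T f x - \int[mu]_x f x| <= C * expR (- beta * n%:R) * (1 + V x)].
Proof.
have [cY _ V0 bV [kappa k0 acS]] := acY.
have [L L1 sync] := synchronous_lipschitz.
have L0 : 0 < L by exact: lt_le_trans L1.
have crude f x n : lipschitz1 f -> `|iter n T f x - \int[mu]_x f x| <= 2.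
  move=> f1; have [f_le1 _] := f1.
  have bf := bounded_continuous_measurable (lipschitz1_bounded_continuous f1).
  have h1 := norm_iter_markov_op_le l cS n bf f_le1 x.
  have h2 : `|\int[mu]_x f x| <= 1 by exact: norm_mean_le.
  by rewrite (le_trans (ler_normB _ _))//; lra.
have split_rate f x k j : lipschitz1 f -> (0 < k)%N ->
    `|iter (k + j) T f x - \int[mu]_x f x| <=
    2 * (1 + V x) * (L ^+ j * expR (- kappa * k%:R)) + C0 * expR (- b * j%:R).
  move=> f1 k1.
  have bf := bounded_continuous_measurable (lipschitz1_bounded_continuous f1).
  (* With [1 + V x] instead of [V x] the distance to [Y] is strictly below [del], so some point of
     [Y] is closer than [del]. *)
  pose del := (1 + V x) * expR (- kappa * k%:R).
  have del0 : 0 < del by rewrite mulr_gt0 ?expR_gt0// ltr_wpDr.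
  have Lj : 1 <= L ^+ j by exact: exprn_ege1.
  have C0e : 0 <= C0 * expR (- b * j%:R) by rewrite mulr_ge0// expR_ge0.
  have -> : 2 * (1 + V x) * (L ^+ j * expR (- kappa * k%:R)) = 2 * (L ^+ j * del).
    by rewrite /del; ring.
  have Ldel : del <= L ^+ j * del by rewrite ler_peMl// ltW.
  (* If [del > 1] the right-hand side exceeds the crude bound 2; otherwise [y] is in the unit
     neighbourhood where [sync] applies. *)
  have [del1|del1] := leP del 1; last by have := crude f x (k + j)%N f1; lra.
  rewrite iterD; apply: iter_markov_op_trajectory => //.
    exact: bounded_measurable_iter_markov_op.
  move=> zeta Ezeta; set y := Defs.iterS S k x zeta.
  have ydel : (dist_to y Y < del%:E)%E.
    rewrite (le_lt_trans (acS x zeta k Ezeta k1))// lte_fin.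
    by rewrite ltr_pM2r ?expR_gt0//; lra.
  have [y' Yy' yy'] := dist_to_lt ydel.
  have y1 : (dist_to y Y <= 1)%E by rewrite (le_trans (ltW ydel))// lee_fin.
  have h1 := sync f j y y' f1 y1 Yy'.
  have h2 := mixing_mean j f1 (YK Yy').
  have h3 : L ^+ j * mdist y y' <= L ^+ j * del.
    by rewrite ler_wpM2l ?(le_trans ler01)// ltW.
  have := ler_normD (iter j T f y - iter j T f y') (iter j T f y' - \int[mu]_x f x).
  by rewrite addrA subrK => /le_trans; apply; lra.
(* With [j] about [n / (s + 1)], at least [s j] steps remain for the approach, and
   [kappa s >= ln L + 1] leaves a net decay [exp (- j)]. Hence the minimum of 1 and [b] below. *)
pose s := (Num.Def.archi_bound ((ln L + 1) / kappa)).+1.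
have lnL : 0 <= ln L by exact: ln_ge0.
have sk : ln L + 1 <= kappa * s%:R.
  rewrite mulrC -ler_pdivrMr// ltW// (lt_trans (archi_boundP _)) ?ltr_nat//.
  by rewrite divr_ge0 ?(ltW k0)// addr_ge0.
pose b1 := Num.min 1 b.
have b10 : 0 < b1 by rewrite lt_min ltr01.
have e1 : expR (- b1) < 1 by rewrite -expR0 ltr_expR oppr_lt0.
have [C [beta [Cp beta0 CP]]] := geometric_exponential (expR_ge0 (- b1)) e1 (ltn0Sn s).
have C02 : 0 < 2 + C0 by rewrite ltr_wpDr.
exists ((2 + C0) * C), beta; split; [by rewrite mulr_gt0|by []|].
move=> f x n f1; pose j := (n %/ s.+1)%N.
have jn : (j * s.+1 <= n)%N by exact: leq_divM.
have V1 : 1 <= 1 + V x by rewrite lerDl.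
suff h : `|iter n T f x - \int[mu]_x f x| <= (2 + C0) * expR (- b1) ^+ j * (1 + V x).
  apply: le_trans h _; rewrite ler_wpM2r ?(le_trans ler01)//.
  by rewrite -mulrA ler_wpM2l ?(ltW C02)//; exact: CP.
have ej : expR (- b1) ^+ j = expR (- (b1 * j%:R)).
  by rewrite -expRM_natl mulrN mulrC.
(* Asymptotic compactness starts at time 1, so time 0 is left to the crude bound; for [n > 0] the
   approach phase [n - j] is nonempty. *)
have [n0|n0] := posnP n.
  have j0 : j = 0%N by rewrite /j n0 div0n.
  rewrite j0 expr0 mulr1 (le_trans (crude f x n f1))//.
  apply: (@le_trans _ _ (2 + C0)); first by rewrite lerDl.
  by rewrite ler_peMr// ltW.
have sj : (s * j <= n - j)%N.
  rewrite leq_subRL; first by rewrite -mulSn mulnC.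
  by rewrite (leq_trans _ jn)// leq_pmulr.
have kpos : (0 < n - j)%N.
  rewrite subn_gt0 /j; apply: ltn_Pdiv => //.
have := split_rate f x (n - j)%N j f1 kpos.
rewrite subnK; last by rewrite (leq_trans _ jn)// leq_pmulr.
move/le_trans; apply.
have A1 : L ^+ j * expR (- kappa * (n - j)%:R) <= expR (- b1) ^+ j.
  rewrite ej -[L in leLHS]lnK ?posrE// -expRM_natl -expRD ler_expR.
  have sjR : (s%:R * j%:R : R) <= (n - j)%:R by rewrite -natrM ler_nat.
  by apply: (split_exponent (ltW k0) _ sk sjR) => //; rewrite ge_min lexx.
have A2 : expR (- b * j%:R) <= expR (- b1) ^+ j.
  rewrite ej ler_expR mulNr lerN2 ler_wpM2r//.
  by rewrite ge_min lexx orbT.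
by apply: split_bound => //; rewrite exprn_ge0// expR_ge0.
Qed.

End rate.

Section dual_lipschitz_norm.
Context {R : realType} {X : polishType R}.

Lemma lip_norm_lipschitz1 (f : X -> R) : (lip_norm f <= 1)%E -> lipschitz1 f.
Proof.
rewrite /lip_norm; set s := ereal_sup _ => h.
have lip0 : (0 <= lip_const f)%E by rewrite /lip_const le_max lexx.
have fs x : (`|f x|%:E <= s)%E by apply: ereal_sup_ubound; exists x.
have s0 : (0 <= s)%E by apply: le_trans (fs point); rewrite lee_fin.
have s1 : (s <= 1)%E by apply: le_trans h; rewrite leeDl.
have lip1 : (lip_const f <= 1)%E by apply: le_trans h; rewrite leeDr.
split=> [x|x y]; first by rewrite -lee_fin (le_trans (fs x)).
have [->|xy] := eqVneq x y; first by rewrite subrr normr0 mdist_ge0.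
have d0 : 0 < mdist x y by rewrite mdist_gt0.
rewrite -[leRHS]mul1r -ler_pdivrMr// -lee_fin (le_trans _ lip1)//.
rewrite /lip_const le_max; apply/orP; right.
by apply: ereal_sup_ubound; exists (x, y).
Qed.

End dual_lipschitz_norm.

(** * Exponential mixing on the attainable set *)

Section contraction_constants.
Context {R : realType} {X Z : polishType R} (S : X -> Z -> X).
Context {d : measure_display} {Omega : measurableType d}.
Variables (P : probability Omega R) (l : probability (borel Z) R).
Variables (xi : nat -> {RV P >-> borel Z}) (E : set Z) (Y : set X).
Hypothesis LS : locally_lipschitz S.
Hypothesis xi_iid : iid xi l.
Hypothesis mE : measurable (E : set (borel Z)).
Hypothesis lE : l E = 1%E.
Hypothesis irrY : irreducibility S xi E Y.
Hypothesis coupY : coupling_hypothesis S xi E Y.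

Local Notation K := (attainable_infty S E Y).
Local Notation T := (markov_op S l).

Let cS : continuous (fun p : X * Z => S p.1 p.2).
Proof. exact: locally_lipschitz_continuous. Qed.

Let SK x z : K x -> E z -> K (S x z).
Proof. exact: attainable_infty_invariant. Qed.

Lemma exponential_mixing : exists C b : R, [/\ 0 < C, 0 < b &
  forall f n x y, lipschitz1 f -> K x -> K y ->
    `|iter n T f x - iter n T f y| <= C * expR (- b * n%:R)].
Proof.
have [r [g [r0 r1 gr [disp [Om1 [P1 [a [a' [ma ma' coup]]]]]]]]] := coupY.
have [q [phi phiP]] := comparison_exists r0 r1 gr.
have mK : measurable (K : set (borel X)).
  by apply: (@borel_closed R X); exact: closed_attainable_infty.
have T_step c f x x' : 0 <= c -> K x -> K x' -> cost_lipschitz K phi c f ->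
    `|T f x - T f x'| <= c * Num.min 1 (phi (r * mdist x x') + g (mdist x x')).
  move=> c0 Kx Kx' fc.
  have [[[ma_x law_x] [ma'_x law'_x]] bad] := coup x x' Kx Kx'.
  apply: (markov_op_coupling cS mE lE SK (@closed_attainable_infty _ _ _ S E Y)
    r0 phiP c0 Kx Kx' ma_x ma'_x _ _ bad fc) => A mA.
  - exact: etrans (law_x A mA) (transitionE cS xi_iid 1%N x mA).
  - exact: etrans (law'_x A mA) (transitionE cS xi_iid 1%N x' mA).
have [q01 phi_mono phi0 phi_min _] := phiP.
have [z Yz zP] := irrY; have Kz : K z by exact: attainable_infty_incl.
have [eps eps0 phieps] := phi0 4%:R^-1 ltac:(by []).
have [m m1 infp] := zP eps eps0.
have mball : measurable (ball z eps : set (borel X)).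
  by apply: (@borel_open R X); exact: open_ball.
have [p p0 ballp] : exists2 p : R, 0 < p &
    forall x, K x -> p <= iter m T \1_(ball z eps) x.
  have Tm x : K x -> (ereal_inf [set transition S xi m x (ball z eps) | x in K] <=
      (iter m T \1_(ball z eps) x)%:E)%E.
    move=> Kx; rewrite -(transitionE cS xi_iid)//.
    by apply: ereal_inf_lbound; exists x.
  (* The infimum cannot be [+oo] because [z] lies in [K]. *)
  move: infp Tm; case: ereal_inf => [p|_ Tm|//].
    by rewrite lte_fin => p0 Tm; exists p.
  by have := Tm z Kz; rewrite leye_eq.
pose q' := Num.max q (1 - p / 2).
have q'0 : 0 <= q' by rewrite le_max; case/andP: q01 => ->.
have q'1 : q' < 1.
  by rewrite gt_max; case/andP: q01 => _ ->; rewrite /= gtrDl oppr_lt0 divr_gt0.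
have [C [b [C0 b0 CP]]] := geometric_exponential q'0 q'1 m1.
exists (2 * C), b; split; [by rewrite mulr_gt0|by []|].
move=> f n x y f1 Kx Ky.
(* Both [2] and the distance bound the variation of [f], so [2 min (1, d)] does, and
   [min 1 t <= phi t] compares this with the cost. *)
have fc : cost_lipschitz K phi 2 f.
  have [f_le1 fL] := f1; split.
    exact/bounded_continuous_measurable/lipschitz1_bounded_continuous.
  move=> u v _ _; have := phi_min _ (mdist_ge0 u v); rewrite /cost.
  have := fL u v; have := ler_normB (f u) (f v); have := f_le1 u; have := f_le1 v.
  rewrite mulr_natl => h1 h2 h3 h4 h5.
  have [phi1|phi1] := leP 1 (phi (mdist u v)); first by rewrite mulr2n; lra.
  have dphi : mdist u v <= phi (mdist u v) by move: h5; rewrite ge_min leNgt phi1.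
  by rewrite mulr2n; have := mdist_ge0 u v; lra.
have := cost_lipschitz_decay cS mE lE SK phiP T_step Kz p0 m1
  phieps ballp n (ler0n R 2) fc Kx Ky.
by move=> /le_trans; apply; rewrite mulrC -mulrA ler_wpM2l//; exact: CP.
Qed.

End contraction_constants.

Local Open Scope ereal_scope.

Theorem theorem2p1 (R : realType) (X Z : polishType R) (S : X -> Z -> X)
    (d : measure_display) (Omega : measurableType d) (P : probability Omega R)
    (l : probability (borel Z) R) (xi : nat -> {RV P >-> borel Z})
    (Y : set X) (V : X -> R) :
  locally_lipschitz S ->
  iid xi l ->
  compact (measure_support (l : set Z -> \bar R)) ->
  asymptotic_compactness S (measure_support (l : set Z -> \bar R)) Y V ->
  irreducibility S xi (measure_support (l : set Z -> \bar R)) Y ->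
  coupling_hypothesis S xi (measure_support (l : set Z -> \bar R)) Y ->
  exists mu : probability (borel X) R,
    [/\ invariant_measure S xi mu,
        (forall mu' : probability (borel X) R, invariant_measure S xi mu' ->
           forall A : set (borel X), measurable A -> mu' A = mu A),
        compact (measure_support (mu : set X -> \bar R)) &
        exists C beta : R,
        [/\ (0 < C)%R, (0 < beta)%R &
        forall nu : probability (borel X) R,
          \int[nu]_x (V x)%:E < +oo ->
          forall n : nat,
            dual_lip (dual_transition S xi n nu) mu
              <= (C * expR (- beta * n%:R))%:E * (1 + \int[nu]_x (V x)%:E)]].
Proof.
move=> LS xi_iid cE acY irrY coupY.
set E := measure_support _ in cE acY irrY coupY.
have cS := locally_lipschitz_continuous LS.
have mE : measurable (E : set (borel Z)).
  by apply: (@borel_closed R Z); exact: closed_support.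
have lE : l E = 1 by exact: support_full.
pose K := attainable_infty S E Y.
have SK x z : K x -> E z -> K (S x z) by exact: attainable_infty_invariant.
have cK : compact K by exact: (compact_attainable_infty cS cE acY).
have [C0 [b [C00 b0 mixing]]] := exponential_mixing LS xi_iid mE lE irrY coupY.
have [z Yz _] := irrY; have Kz : K z by exact: attainable_infty_incl.
have [|mu [muK mu_stat]] := stationary_measure LS cE mE lE SK cK Kz.
  move=> f f1.
  have bf := bounded_continuous_measurable (lipschitz1_bounded_continuous f1).
  apply/cvgr0Pnorm_le => eps eps0.
  have [N NP] := expR_decay_lt b0 eps0 (ltW C00).
  exists N => // n /= Nn; apply: le_trans (ltW (NP n Nn)).
  (* [T^(n+1) f z] is the mean of [T^n f] over the successors of [z], which lie in [K], so mixing
     compares it with [T^n f z]. *)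
  apply: (dist_mean_full mE lE).
    apply: (bounded_measurable_step cS (f := iter n (markov_op S l) f)).
    exact: bounded_measurable_iter_markov_op.
  by move=> u Eu; apply: mixing => //; exact: SK.
have [C [beta [Cp beta0 rate]]] := pointwise_rate LS cE mE lE cK
  (@attainable_infty_incl _ _ _ S E Y) acY (ltW C00) b0 mixing muK mu_stat.
have [_ mV V0 _ _] := acY.
have mean_dual n nu f : lipschitz1 f ->
    \int[dual_transition S xi n nu]_x (f x)%:E =
    (\int[nu]_x iter n (markov_op S l) f x)%R%:E.
  move=> f1.
  have bf := bounded_continuous_measurable (lipschitz1_bounded_continuous f1).
  rewrite (dual_transitionE cS) -(mean_dual_probability cS xi_iid)//.
  by rewrite EFin_mean.
have bmT f n : lipschitz1 f -> bounded_measurable (iter n (markov_op S l) f).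
  move=> f1; apply: bounded_measurable_iter_markov_op => //.
  exact/bounded_continuous_measurable/lipschitz1_bounded_continuous.
exists mu; split.
- move=> n A mA; have b1 := bounded_measurable_indic (R := R) mA.
  rewrite (dual_transitionE cS) -[LHS](mean_indic _ mA).
  rewrite (mean_dual_probability cS xi_iid)//.
  by rewrite (mean_iter_markov_op LS mu_stat)// mean_indic.
(* The mean of [T^n f] under [mu'] does not depend on [n], while [T^n f] stays bounded by 1 and
   tends pointwise to the [mu]-mean of [f]; so the two means of [f] agree. *)
- move=> mu' inv' A mA; apply: eq_probability_lipschitz1 => // f f1.
  have bf := bounded_continuous_measurable (lipschitz1_bounded_continuous f1).
  have mean_const n : (\int[mu']_x iter n (markov_op S l) f x = \int[mu']_x f x)%R.
    rewrite -(mean_dual_probability cS xi_iid)//.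
    apply: eq_measure_mean => B mB.
    by have := inv' n B mB; rewrite (dual_transitionE cS).
  set c := (\int[mu]_x f x)%R.
  have /cvg_lim <- // : (\int[mu']_x iter n (markov_op S l) f x)%R @[n --> \oo] --> c.
    rewrite -(mean_cst mu' c).
    apply: (mean_bounded_cvg (M := 1%R)) => [n||n x|x].
    + exact: bmT.
    + exact: bounded_measurable_cst.
    + by apply: norm_iter_markov_op_le => //; case: f1.
    + apply/cvgrPdist_le => eps eps0.
      have CV : (0 <= C * (1 + V x))%R by rewrite mulr_ge0 ?(ltW Cp)// addr_ge0.
      have [N NP] := expR_decay_lt beta0 eps0 CV.
      exists N => // n /= Nn; rewrite distrC; apply: le_trans (rate f x n f1) _.
      by rewrite mulrAC ltW// NP.
  apply/esym/cvg_lim => //; apply: cvg_near_cst; apply: nearW => n.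
  exact: mean_const.
(* The complement of [K] is open and null, so the support lies in [K]. *)
- apply: (subclosed_compact _ cK); first exact: closed_support.
  move=> x xmu; apply: contrapT => nKx.
  have clK : closed K by exact: closed_attainable_infty.
  have := xmu (~` K) (closed_openC clK) nKx.
  rewrite probability_setC ?muK ?subee ?ltxx//.
  exact: (@borel_closed R X).
- exists C, beta; split=> // nu _ n.
  apply: ge_ereal_sup => _ [f /lip_norm_lipschitz1 f1 <-].
  have bf := bounded_continuous_measurable (lipschitz1_bounded_continuous f1).
  rewrite mean_dual// -(EFin_mean mu bf) -EFinB.
  have -> : (\int[nu]_x iter n (markov_op S l) f x - \int[mu]_x f x =
      \int[nu]_x (iter n (markov_op S l) f x - \int[mu]_x f x))%R.
    rewrite meanB ?mean_cst//; [exact: bmT|exact: bounded_measurable_cst].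
  have bd : bounded_measurable (fun x => iter n (markov_op S l) f x - \int[mu]_x f x)%R.
    by apply: bounded_measurableB; [exact: bmT|exact: bounded_measurable_cst].
  rewrite abse_EFin.
  apply: (@le_trans _ _ (\int[nu]_x `|iter n (markov_op S l) f x - \int[mu]_x f x|)%R%:E).
    rewrite lee_fin; apply: le_normr_Rintegral => //.
    exact: bounded_measurable_integrable.
  rewrite EFin_mean; last exact: bounded_measurable_norm.
  have Ce0 : (0 <= C * expR (- beta * n%:R))%R by rewrite mulr_ge0 ?expR_ge0// ltW.
  have mVE : measurable_fun [set: borel X] (fun x : borel X => (V x)%:E).
    exact/measurable_EFinP.
  apply: (@le_trans _ _ (\int[nu]_x ((C * expR (- beta * n%:R))%:E * (1 + (V x)%:E)))).
    apply: ge0_le_integral => //.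
    + by apply/measurable_EFinP; case: (bounded_measurable_norm bd).
    + by apply: measurable_funeM; exact: emeasurable_funD.
    + by move=> x _; rewrite -EFinD -EFinM lee_fin; exact: rate.
  rewrite ge0_integralZl//.
  + rewrite ge0_integralD//.
    * by rewrite integral_cst// mul1e [X in X + _]probability_setT.
    * by move=> x _; rewrite lee_fin.
  + exact: emeasurable_funD.
  + by move=> x _; rewrite -EFinD lee_fin addr_ge0.
Qed.
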